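(* For every $q\in(0,1)$ and $\delta>0$ there are $N<\infty$, $\theta\in\mathbb R^N$, and a positive definite correlation matrix $\Sigma\in\mathbb R^{N\times N}$ (symmetric, positive definite, unit diagonal) such that the level-$q$ Benjamini–Hochberg procedure, applied to the one-sided $p$-values $P_i=\overline\Phi(T_i)$ from $T\sim N(\theta,\Sigma)$ for the hypotheses $H_i:\theta_i\le0$, satisfies $$\mathrm{FDR}_{\theta,\Sigma}(\mathrm{BH}_q)>\ell_{\le}(q)-\delta,$$ and such that, moreover, every true null has $\theta_i=0$ and every non-null has $\theta_i>0$.
   Context: $\Phi$ is the standard normal CDF and $\overline\Phi=1-\Phi$. $H_i$ is a true null iff $\theta_i\le0$. Benjamini–Hochberg procedure at level $q$ ($\mathrm{BH}_q$): given $p$-values $P_1,\dots,P_N$ with order statistics $P_{(1)}\le\dots\le P_{(N)}$, put $R=\max\{1\le k\le N: P_{(k)}\le qk/N\}$ ($R=0$ if the set is empty) and reject the hypotheses corresponding to $P_{(1)},\dots,P_{(R)}$. If $V$ is the number of rejected true nulls, $\mathrm{FDP}=V/(R\vee1)$ and $\mathrm{FDR}=\mathbb E(\mathrm{FDP})$. For $0<q<1$, $y_q^+=\sqrt{2\log(1/q)}$ and $$\ell_{\le}(q)=\frac{q\sqrt{\log(1/q)}}{\sqrt\pi}+\frac q2+\overline\Phi(y_q^+).$$ *)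

(* Defs.v *)
From HB Require Import structures.
From mathcomp Require Import all_boot all_order all_algebra.
From mathcomp Require Import all_classical all_reals all_analysis.

Set Implicit Arguments.
Unset Strict Implicit.
Unset Printing Implicit Defensive.

Import Order.TTheory GRing.Theory Num.Theory.
Import numFieldNormedType.Exports.

Local Open Scope classical_set_scope.
Local Open Scope ring_scope.

(* [R^n] is [n.-tuple R], the representation for which the library provides the
   product sigma-algebra. The library has no Lebesgue measure on it, so
   [lebesgue_tuple n] is built below by iterating binary products:
   it is the unit mass on [R^0], and on [R^n.+1] the image of
   [lebesgue_measure \x lebesgue_tuple n] under [(x, t) |-> x :: t]. *)
Section lebesgue_tuple_step.
Context (R : realType) (n : nat).
Variable mu : {sigma_finite_measure set (n.-tuple (measurableTypeR R)) -> \bar R}.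

Definition tuple_cons (p : measurableTypeR R * n.-tuple (measurableTypeR R)) :
  n.+1.-tuple (measurableTypeR R) := [tuple of p.1 :: p.2].

Lemma measurable_tuple_cons : measurable_fun [set: _] tuple_cons.
Proof. by apply: measurable_cons. Qed.

Definition tuple_uncons (t : n.+1.-tuple (measurableTypeR R)) :
  measurableTypeR R * n.-tuple (measurableTypeR R) :=
  (thead t, [tuple of behead t]).

Lemma tuple_consK : cancel tuple_cons tuple_uncons.
Proof. by case=> x t; congr pair; apply/val_inj. Qed.

Lemma tuple_unconsK : cancel tuple_uncons tuple_cons.
Proof. by move=> t; rewrite [RHS]tuple_eta. Qed.

Lemma measurable_tuple_uncons : measurable_fun [set: _] tuple_uncons.
Proof.
apply: measurable_fun_pair; last exact: measurable_behead.
exact: measurable_tnth.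
Qed.

Definition lebesgue_cons : set (n.+1.-tuple (measurableTypeR R)) -> \bar R :=
  pushforward (lebesgue_measure \x mu)%E tuple_cons.

Let lebesgue_cons0 : lebesgue_cons set0 = 0%E.
Proof. by rewrite /lebesgue_cons /pushforward preimage_set0 measure0. Qed.

Let lebesgue_cons_ge0 A : (0 <= lebesgue_cons A)%E.
Proof. by rewrite /lebesgue_cons /pushforward measure_ge0. Qed.

Let lebesgue_cons_sigma_additive : semi_sigma_additive lebesgue_cons.
Proof.
move=> F mF tF mUF; rewrite /lebesgue_cons /pushforward preimage_bigcup.
apply: measure_semi_sigma_additive.
- by move=> k; rewrite -[X in measurable X]setTI; exact: measurable_tuple_cons.
- apply/trivIsetP => /= i j _ _ ij; rewrite -preimage_setI.
  by move/trivIsetP : tF => /(_ _ _ _ _ ij) ->//; rewrite preimage_set0.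
- rewrite -preimage_bigcup -[X in measurable X]setTI.
  exact: measurable_tuple_cons.
Qed.

HB.instance Definition _ := isMeasure.Build _ _ _ lebesgue_cons
  lebesgue_cons0 lebesgue_cons_ge0 lebesgue_cons_sigma_additive.

Let lebesgue_cons_sigma_finite : sigma_finite [set: _] lebesgue_cons.
Proof.
have /sigma_finiteP[F [TF ndF Foo]] := sigma_finiteT (@lebesgue_measure R).
have /sigma_finiteP[G [TG ndG Goo]] := sigma_finiteT mu.
exists (fun k => tuple_uncons @^-1` (F k `*` G k)).
  rewrite -preimage_bigcup (_ : \bigcup_k _ = setT) ?preimage_setT //.
  apply/seteqP; split=> // -[x t] _.
  have [k _ Fkx] : (\bigcup_k F k) x by rewrite -TF.
  have [l _ Glt] : (\bigcup_l G l) t by rewrite -TG.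
  exists (maxn k l) => //; split.
    by move: x Fkx; exact/subsetPset/ndF/leq_maxl.
  by move: t Glt; exact/subsetPset/ndG/leq_maxr.
move=> k; have [mF Fkoo] := Foo k; have [mG Gkoo] := Goo k; split.
  rewrite -[X in measurable X]setTI; apply: measurable_tuple_uncons => //.
  exact: measurableX.
rewrite /lebesgue_cons /pushforward -comp_preimage.
rewrite (_ : tuple_uncons \o tuple_cons = id); last exact/funext/tuple_consK.
by rewrite preimage_id product_measure1E// lte_mul_pinfty// ge0_fin_numE.
Qed.

HB.instance Definition _ := Measure_isSigmaFinite.Build _ _ _ lebesgue_cons
  lebesgue_cons_sigma_finite.

End lebesgue_tuple_step.

Fixpoint lebesgue_tuple (R : realType) (n : nat) :
    {sigma_finite_measure set (n.-tuple (measurableTypeR R)) -> \bar R} :=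
  match n with
  | 0 => \d_[tuple]
  | m.+1 => lebesgue_cons (lebesgue_tuple R m)
  end.

Section normal.
Context {R : realType}.

Definition Phi (x : R) : R := fine (normal_prob 0 1 `]-oo, x]).

Definition Phibar (x : R) : R := 1 - Phi x.

Definition posdefmx (N : nat) (S : 'M[R]_N) : Prop :=
  forall x : 'rV[R]_N, x != 0 -> 0 < (x *m S *m x^T) 0 0.

Definition correlation_mx (N : nat) (S : 'M[R]_N) : Prop :=
  [/\ S^T = S, posdefmx S & forall i, S i i = 1].

(* Density of N(theta, S) with respect to [lebesgue_tuple R N]; this is the
   normal law only for S symmetric positive definite. *)
Definition mvnormal_pdf (N : nat) (theta : 'rV[R]_N) (S : 'M[R]_N)
    (t : N.-tuple R) : R :=
  let x := \row_i tnth t i - theta in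
  (Num.sqrt ((pi *+ 2) ^+ N * \det S))^-1 *
  expR (- (x *m invmx S *m x^T) 0 0 / 2).

End normal.

Section benjamini_hochberg.
Context {R : realType} (q : R) {N : nat}.
Implicit Types (p t : N.-tuple R) (theta : 'rV[R]_N).

(* The k-th smallest p-value, for 1 <= k <= N. *)
Definition order_stat p (k : nat) : R := nth 0 (sort <=%R p) k.-1.

Definition BH_count p : nat :=
  \max_(k < N.+1 | (0 < k)%N && (order_stat p k <= q * k%:R / N%:R)) k.

(* Thresholding at the order statistic of rank [BH_count p] is unambiguous
   under ties: by maximality exactly [BH_count p] p-values are below it. *)
Definition BH_rejected p : {set 'I_N} :=
  [set i | (0 < BH_count p)%N && (tnth p i <= order_stat p (BH_count p))].

Definition true_null theta : {set 'I_N} := [set i | theta 0 i <= 0].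

Definition FDP theta p : R :=
  #|BH_rejected p :&: true_null theta|%:R / (maxn (BH_count p) 1)%:R.

Definition pvalues t : N.-tuple R := [tuple Phibar (tnth t i) | i < N].

(* The expectation of the FDP under T ~ N(theta, S). *)
Definition FDR theta (S : 'M[R]_N) : \bar R :=
  (\int[lebesgue_tuple R N]_t
     (FDP theta (pvalues t) * mvnormal_pdf theta S t)%:E)%E.

End benjamini_hochberg.

Section lower_bound.
Context {R : realType}.

Definition y_plus (q : R) : R := Num.sqrt (2 * ln (1 / q)).

Definition ell_le (q : R) : R :=
  q * Num.sqrt (ln (1 / q)) / Num.sqrt pi + q / 2 + Phibar (y_plus q).

End lower_bound.

(* Main.v *)
(* With y = y_q^+ and phi the standard normal density, q phi(0) y is the first
   term of ell_le(q), so ell_le(q) = E[g(Z)] for Z ~ N(0, 1), where g = q on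
   ]-oo, 0], g(z) = q exp(z^2 / 2) on [0, y] and g = 1 on [y, +oo[. The value
   q exp(z^2 / 2) is the best ratio one factor can give: for a null
   T = a Z + sqrt(1 - a^2) eps and the threshold t = z / a, monotonicity of the
   Mills ratio yields P(T > t | Z = z) >= exp(z^2 / 2) Phibar(t).

   Take Z itself as a coordinate, let almost all coordinates be such nulls with
   a small, and cut the line into bands ]l_k, u_k[ with thresholds t_k = z_k / a.
   A few non-nulls, almost equal to a constant minus Z, come in groups: group j
   exceeds t_j as long as Z < u_j and has dropped well below t_j once
   Z > u_j + eta. For Z in band k the groups j >= k provide just enough
   rejections to make BH stop at t_k or lower, with non-null proportion at most
   1 - g(z_k). No upper control of the null count is needed: if BH stops so low
   that a group j < k is rejected, then it rejects at least
   N Phibar(t_j - eta / 4) / q hypotheses, which dwarfs the number of non-nulls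
   in the groups >= j. *)

Require Import Defs.
From HB Require Import structures.
From mathcomp Require Import all_boot all_order all_algebra.
From mathcomp Require Import all_classical all_reals all_analysis.
From mathcomp Require Import measurable_realfun.
From mathcomp Require Import ring lra.

Set Implicit Arguments.
Unset Strict Implicit.
Unset Printing Implicit Defensive.

Import Order.TTheory GRing.Theory Num.Theory.
Import numFieldNormedType.Exports.

Local Open Scope classical_set_scope.
Local Open Scope ring_scope.

(** * Gaussian tails *)

Section univariate.
Context {R : realType}.
Implicit Types m s t v x : R.
Local Notation mu := lebesgue_measure.

Lemma integral_tail_affine m s t (G : R -> R) : 0 < s -> continuous G ->
  (forall x, 0 <= G x) ->
  (\int[mu]_(x in `[((t - m) / s)%R, +oo[) (G x)%:E =
   \int[mu]_(x in `[t, +oo[) (G ((x - m) / s) / s)%:E)%E.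
Proof.
move=> s0 cG G0; pose F (x : R^o) : R^o := (x - m) / s.
have F'E : F^`()%classic = cst s^-1.
  apply/funext => x; rewrite /F derive1E deriveM// deriveD// derive_cst scaler0.
  by rewrite add0r derive_id derive_cst addr0 scaler1.
have cF : continuous F.
  by move=> x; apply: cvgMr_tmp; apply: cvgB; [exact: cvg_id|exact: cvg_cst].
rewrite -[((t - m) / s)%R]/(F t) (@increasing_ge0_integration_by_substitutiony _ F).
- by apply: eq_integral => x _; rewrite F'E.
- by move=> x y _ _ xy; rewrite /F ltr_pM2r ?invr_gt0// ltrD2r.
- by rewrite F'E => ? _; exact: cvg_cst.
- by rewrite F'E; exact: is_cvg_cst.
- by rewrite F'E; exact: is_cvg_cst.
- split; last by apply: cvg_at_right_filter; exact: cF.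
  by move=> x _; apply: derivableM => //; apply: derivableB.
- by apply/gt0_cvgMly; [rewrite invr_gt0|exact: cvg_addrr].
- by apply: continuous_subspaceT => x; exact: cG.
- by move=> x _; exact: G0.
Qed.

Lemma measurable_EFin_normal_pdf m s (D : set R) :
  measurable_fun D (fun x => (normal_pdf m s x)%:E).
Proof.
apply: measurable_funTS; apply/measurable_EFinP; exact: measurable_normal_pdf.
Qed.

Lemma normal_pdf01E x :
  normal_pdf 0 1 x = (Num.sqrt (pi *+ 2))^-1 * expR (- x ^+ 2 / 2).
Proof.
by rewrite normal_pdfE ?oner_neq0// /normal_peak /normal_fun subr0 expr1n mul1r.
Qed.

Lemma normal_pdf_standardize m s x : 0 < s ->
  normal_pdf m s x = normal_pdf 0 1 ((x - m) / s) / s.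
Proof.
move=> s0; have sN0 : s != 0 by rewrite gt_eqF.
rewrite normal_pdf01E normal_pdfE// /normal_peak /normal_fun.
rewrite -mulrnAr sqrtrM ?sqr_ge0// sqrtr_sqr gtr0_norm// invfM.
rewrite [RHS]mulrAC; congr (_ * expR _); first exact: mulrC.
by field.
Qed.

Lemma Phibar_itv t : normal_prob 0 1 `[t, +oo[ = (Phibar t)%:E.
Proof.
rewrite /Phibar /Phi EFinB fineK; last exact: fin_num_measure.
rewrite -[(1%:E)%E]/(1%E) -probability_setC// setCitvl.
rewrite -[RHS]/(\int[mu]_(x in `]t, +oo[) (normal_pdf 0 1 x)%:E)%E.
rewrite /normal_prob integral_itv_obnd_cbnd//.
exact: measurable_EFin_normal_pdf.
Qed.

Lemma normal_prob_itvcy m s t : 0 < s ->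
  normal_prob m s `[t, +oo[ = (Phibar ((t - m) / s))%:E.
Proof.
move=> s0; rewrite -Phibar_itv /normal_prob (@integral_tail_affine m s)//.
- by apply: eq_integral => x _; rewrite [in LHS]normal_pdf_standardize.
- by apply: continuous_normal_pdf; rewrite oner_neq0.
- exact: normal_pdf_ge0.
Qed.

Lemma Phibar_ge0 t : 0 <= Phibar t.
Proof. by rewrite -lee_fin -Phibar_itv. Qed.

Lemma Phibar_le1 t : Phibar t <= 1.
Proof. by rewrite -lee_fin -Phibar_itv; exact: probability_le1. Qed.

Lemma Phibar_le v t : v <= t -> Phibar t <= Phibar v.
Proof.
move=> vt; rewrite -lee_fin -!Phibar_itv; apply: le_measure; rewrite ?inE//.
by apply: subset_itvr; rewrite bnd_simp.
Qed.

(* The Mills ratio is nonincreasing: shift the tail integral of t by t - v and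
   compare the densities pointwise. *)
Lemma Phibar_mills v t : v <= t ->
  Phibar t <= expR (- (t ^+ 2 - v ^+ 2) / 2) * Phibar v.
Proof.
move=> vt; have tE : t = (v - (v - t)) / 1 by field.
rewrite -lee_fin EFinM {1}tE -normal_prob_itvcy// -Phibar_itv /normal_prob.
rewrite -ge0_integralZl//=.
- apply: ge0_le_integral => //=.
  + by move=> x _; rewrite lee_fin normal_pdf_ge0.
  + exact: measurable_EFin_normal_pdf.
  + apply: measurable_funeM; exact: measurable_EFin_normal_pdf.
  + move=> x /=; rewrite in_itv/= andbT => vx.
    rewrite -EFinM lee_fin (@normal_pdf_standardize (v - t) 1)// !divr1 !normal_pdf01E.
    rewrite mulrCA ler_wpM2l ?invr_ge0 ?sqrtr_ge0// -expRD ler_expR.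
    have : 0 <= (t - v) * (x - v) by rewrite mulr_ge0 ?subr_ge0.
    move=> h; nra.
- exact: measurable_EFin_normal_pdf.
- by move=> x _; rewrite lee_fin normal_pdf_ge0.
Qed.

Lemma PhibarN t : Phibar (- t) = 1 - Phibar t.
Proof.
suff : (Phibar (- t))%:E = (1 - (Phibar t)%:E)%E by case.
rewrite -!Phibar_itv -probability_setC// setCitvr.
rewrite -[RHS]/(\int[mu]_(x in `]-oo, t[) (normal_pdf 0 1 x)%:E)%E.
rewrite /normal_prob integral_itv_bndo_bndc; last first.
  exact: measurable_EFin_normal_pdf.
rewrite -[t in RHS]opprK ge0_integration_by_substitutionNy.
- by apply: eq_integral => x _; rewrite /= !normal_pdf01E sqrrN.
- apply: continuous_subspaceT; apply: continuous_normal_pdf.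
  by rewrite oner_neq0.
- by move=> x _; exact: normal_pdf_ge0.
Qed.

Lemma Phibar0 : Phibar 0 = 2^-1 :> R.
Proof. by have := PhibarN 0; rewrite oppr0 => h; lra. Qed.

(** The density decreases in [|x|], so its value at [c] bounds it from below on the whole
    interval. *)
Lemma normal_prob_itv_ge a b c : a <= b ->
  (forall x, a < x < b -> x ^+ 2 <= c ^+ 2) ->
  (((b - a) * normal_pdf 0 1 c)%:E <= normal_prob 0%R 1%R `]a, b[)%E.
Proof.
move=> ab abc.
rewrite /normal_prob (@le_trans _ _ (\int[mu]_(x in `]a, b[) (normal_pdf 0 1 c)%:E)%E)//.
  rewrite integral_cst//= lebesgue_measure_itv/= lte_fin.
  case: ltP => [_|ba]; first by rewrite mulrC EFinM.
  by rewrite mule0 (@le_anti _ _ a b) ?ab// subrr mul0r.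
apply: ge0_le_integral => //=.
- by move=> x _; rewrite lee_fin normal_pdf_ge0.
- exact: measurable_EFin_normal_pdf.
- move=> x; rewrite in_itv/= => /abc xc; rewrite lee_fin !normal_pdf01E.
  by rewrite ler_wpM2l ?invr_ge0 ?sqrtr_ge0// ler_expR; lra.
Qed.

Lemma Phibar_gt0 t : 0 < Phibar t.
Proof.
have sub : (`]t, t + 1[ `<=` `[t, +oo[)%classic by apply: subset_itv; rewrite bnd_simp.
rewrite -lte_fin -Phibar_itv (@lt_le_trans _ _ (normal_prob 0%R 1%R `]t, t + 1[))//.
  have t1 : t <= t + 1 by lra.
  have tc x : t < x < t + 1 -> x ^+ 2 <= (`|t| + 1) ^+ 2.
    move=> /andP[tx xt1]; rewrite -[x ^+ 2]real_normK ?num_real//.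
    have xt : `|x| <= `|t| + 1.
      have : `|x - t| <= 1 by rewrite ler_norml; apply/andP; lra.
      by have := ler_normD (x - t) t; rewrite subrK; lra.
    by rewrite ler_sqr ?nnegrE// addr_ge0.
  apply: lt_le_trans (normal_prob_itv_ge t1 tc).
  rewrite lte_fin addrC addKr mul1r normal_pdf01E mulr_gt0 ?expR_gt0//.
  by rewrite invr_gt0 sqrtr_gt0 pmulrn_lgt0// pi_gt0.
by apply: le_measure; rewrite ?inE.
Qed.

(** The density is at most [1 / sqrt (2 pi)], hence at most 1. *)
Lemma Phibar_lipschitz v t : v <= t -> Phibar v <= Phibar t + (t - v).
Proof.
move=> vt; rewrite -lee_fin (EFinD (Phibar t)) -!Phibar_itv.
have -> : (`[v, +oo[ = `[v, t[ `|` `[t, +oo[)%classic.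
  by rewrite -itv_bndbnd_setU ?bnd_simp.
rewrite measureU//=; last first.
  rewrite -subset0 => x []/=; rewrite !in_itv/= => /andP[_ xt].
  by rewrite andbT leNgt xt.
rewrite addeC leeD2l//.
rewrite /normal_prob (@le_trans _ _ (\int[mu]_(x in `[v, t[) (cst 1%E x))%E)//.
  apply: ge0_le_integral => //=.
  - by move=> x _; rewrite lee_fin normal_pdf_ge0.
  - exact: measurable_EFin_normal_pdf.
  - move=> x _; rewrite lee_fin.
    rewrite (le_trans (normal_pdf_ub _ _ (oner_neq0 _)))//.
    rewrite /normal_peak invf_le1 ?sqrtr_gt0 expr1n mul1r.
      rewrite -sqrtr1 ler_sqrt//; have := pi_ge2 R; lra.
    by rewrite pmulrn_lgt0// pi_gt0.
rewrite integral_cst//= lebesgue_measure_itv/= lte_fin mul1e.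
by case: ltP => // _; rewrite lee_fin subr_ge0.
Qed.

Lemma Phibar_small (e : R) : 0 < e -> exists2 t, 0 < t & Phibar t <= e.
Proof.
move=> e0; have ei0 : 0 < e^-1 by rewrite invr_gt0.
(* For this [t], [t >= 1] gives [t ^+ 2 >= t], and [exp (t / 2) >= 1 + t / 2 >= 1 / e]. *)
exists (1 + 2 * e^-1); first lra.
set t := 1 + _; have t0 : 0 <= t by rewrite /t; lra.
apply: le_trans (Phibar_mills t0) _; rewrite Phibar0 expr0n subr0.
apply: (@le_trans _ _ (expR (- (t / 2)))).
  rewrite -[leRHS]mulr1 ler_pM ?expR_ge0 ?invr_ge0//; last lra.
  rewrite ler_expR; have : 1 <= t by rewrite /t; lra.
  nra.
rewrite expRN invf_ple ?posrE ?expR_gt0//.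
by apply: le_trans (expR_ge1Dx _); rewrite /t; lra.
Qed.

End univariate.

(** * The BH procedure *)

Section bh.
Context {R : realType} (q : R) {N : nat}.
Implicit Types (p : N.-tuple R) (x tau f : R) (theta : 'rV[R]_N).

Lemma card_tnth (P : pred R) p : #|[pred i | P (tnth p i)]| = count P p.
Proof.
rewrite -sum1_card big_mkcond/= -[in RHS](map_tnth_enum p) count_map.
by rewrite -sum1_count big_enum_cond [RHS]big_mkcond.
Qed.

Let sorted_p p : sorted <=%O (sort <=%R p).
Proof. by apply: sort_sorted; exact: le_total. Qed.

Lemma order_stat_le p (k : nat) x : (0 < k)%N ->
  (k <= #|[pred i | (tnth p i <= x)%R]|)%N -> order_stat p k <= x.
Proof.
move=> k0; rewrite (card_tnth (<= x)) => kx; apply: nth_count_le => //.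
by rewrite count_sort prednK.
Qed.

Lemma card_le_order_stat p (k : nat) : (0 < k <= N)%N ->
  (k <= #|[pred i | (tnth p i <= order_stat p k)%R]|)%N.
Proof.
move=> /andP[k0 kN]; rewrite (card_tnth (<= order_stat p k)) leqNgt.
apply/negP => ck.
suff : order_stat p k < nth 0 (sort <=%R p) k.-1 by rewrite /order_stat ltxx.
apply: nth_count_gt => //; rewrite count_sort size_sort size_tuple prednK// kN.
by rewrite andbT -ltnS prednK.
Qed.

Lemma BH_countP p : (0 < BH_count q p)%N ->
  (BH_count q p <= N)%N /\
  order_stat p (BH_count q p) <= q * (BH_count q p)%:R / N%:R.
Proof.
rewrite /BH_count; elim/big_ind: _ => //.
- by move=> a b ha hb; rewrite /maxn; case: ifP.
- by move=> i /andP[_ ?] _; split => //; rewrite -ltnS.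
Qed.

Lemma BH_count_ge p (k : nat) : (0 < k <= N)%N ->
  order_stat p k <= q * k%:R / N%:R -> (k <= BH_count q p)%N.
Proof.
move=> /andP[k0 kN] pk; rewrite -ltnS in kN.
by apply: (@leq_bigmax_cond _ _ _ (Ordinal kN)); rewrite /= k0.
Qed.

Lemma FDP_ge0 theta p : 0 <= FDP q theta p.
Proof. by rewrite /FDP divr_ge0. Qed.

(* Once BH rejects at threshold tau it rejects at some threshold x >= tau with
   exactly N x / q rejections, so bounding the non-null rejections by a
   fraction of N x / q for every x >= tau controls the FDP wherever BH stops. *)
Lemma FDP_ge theta p tau f : (0 < N)%N -> 0 < q -> 0 < tau ->
  N%:R * tau / q <= #|[pred i | (tnth p i <= tau)%R]|%:R ->
  (forall x, tau <= x ->
    #|[pred i | (tnth p i <= x)%R && (i \notin true_null theta)]|%:R <=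
      (1 - f) * (N%:R * x / q)) ->
  f <= FDP q theta p.
Proof.
move=> N0 q0 tau0 htau hx; have N0' : 0 < N%:R :> R by rewrite ltr0n.
set r := #|_| in htau.
have r0 : (0 < r)%N.
  by rewrite -(ltr0n R); apply: lt_le_trans htau; rewrite divr_gt0 ?mulr_gt0.
have rN : (r <= N)%N by rewrite -[leqRHS]card_ord max_card.
have rB : (r <= BH_count q p)%N.
  apply: BH_count_ge; first by rewrite r0.
  apply: le_trans (order_stat_le r0 (leqnn _)) _.
  by rewrite ler_pdivlMr// [leRHS]mulrC -ler_pdivrMr// [tau * _]mulrC.
have B0 : (0 < BH_count q p)%N by exact: leq_trans rB.
have [BN Bx] := BH_countP B0.
set B := BH_count q p in rB B0 BN Bx.
have B0' : 0 < B%:R :> R by rewrite ltr0n.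
(* The threshold at which BH stops: it solves [N x / q = B], and it is at least [tau] because
   [r <= B]. *)
set x := q * B%:R / N%:R in Bx.
have taux : tau <= x.
  rewrite /x ler_pdivlMr// [leRHS]mulrC -ler_pdivrMr// [tau * _]mulrC (le_trans htau)//.
  by rewrite ler_nat.
have NxB : N%:R * x / q = B%:R.
  by rewrite /x; field; rewrite !gt_eqF.
have := hx _ taux; rewrite NxB => V1.
rewrite /FDP -/B (maxn_idPl B0) ler_pdivlMr//.
(* Every rejected p-value is at most [x], so the rejections split into rejected nulls and non-nulls
   already bounded by [V1]. *)
have BE : (B <= #|BH_rejected q p :&: true_null theta| +
  #|[pred i | (tnth p i <= x)%R && (i \notin true_null theta)]|)%N.
  apply: (@leq_trans #|BH_rejected q p|).
    rewrite (leq_trans (@card_le_order_stat p B _)) ?B0//.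
    by apply: subset_leq_card; apply/fintype.subsetP => i; rewrite !inE -/B B0.
  rewrite -(cardsID (true_null theta)) leq_add2l subset_leq_card//.
  apply/fintype.subsetP => i; rewrite !inE => /andP[-> /andP[_ pB]].
  by rewrite (le_trans pB).
rewrite -(ler_nat R) natrD in BE; lra.
Qed.

End bh.

(** * The one-factor Gaussian model *)

Lemma sqrtr_prod {R : rcfType} (I : finType) (P : pred I) (F : I -> R) :
  (forall i, P i -> 0 <= F i) ->
  Num.sqrt (\prod_(i | P i) F i) = \prod_(i | P i) Num.sqrt (F i).
Proof.
move=> F0; suff [] : 0 <= \prod_(i | P i) F i /\
  Num.sqrt (\prod_(i | P i) F i) = \prod_(i | P i) Num.sqrt (F i) by [].
elim/big_ind2 : _ => [|x1 y1 x2 y2 [x10 <-] [x20 <-]|i Pi].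
- by rewrite sqrtr1.
- by rewrite mulr_ge0// sqrtrM.
- by rewrite F0.
Qed.

Section factor_model.
Context {R : realType} {n : nat}.
Variables (m a s : 'I_n -> R).
Implicit Types (z : R) (t : n.-tuple R).

(* The law of (Z, (m i + a i Z + s i eps_i)_i) for iid standard normal Z and
   eps_i: the factor Z is itself the coordinate [ord0]. *)
Definition factor_mean : 'rV[R]_(1 + n) := row_mx (0 : 'rV[R]_1) (\row_i m i).

Let A : 'rV[R]_n := \row_i a i.
Let D : 'M[R]_n := diag_mx (\row_i s i ^+ 2).

Definition factor_cov : 'M[R]_(1 + n) :=
  block_mx (1%:M : 'M[R]_1) A A^T (A^T *m A + D).

(** [L] carries (Z, (s i eps_i)_i) to the centred coordinates, and [M] undoes this by subtracting
    [a i Z]; in between the covariance is diagonal. *)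
Let L : 'M[R]_(1 + n) := block_mx 1%:M 0 A^T 1%:M.
Let M : 'M[R]_(1 + n) := block_mx 1%:M 0 (- A^T) 1%:M.

Let covE : factor_cov = L *m block_mx 1%:M 0 0 D *m L^T.
Proof.
rewrite /factor_cov /L tr_block_mx !mulmx_block !trmx1 trmxK trmx0.
by rewrite !(mul0mx, mulmx0, mulmx1, mul1mx, addr0, add0r).
Qed.

Let LM : L *m M = 1%:M.
Proof.
rewrite /L /M mulmx_block !(mul0mx, mulmx0, mulmx1, mul1mx, addr0, add0r).
by rewrite subrr -scalar_mx_block.
Qed.

Let ML : M *m L = 1%:M.
Proof. exact: mulmx1C LM. Qed.

Let quad_diag (y0 : 'rV[R]_1) (y d : 'rV[R]_n) :
  (row_mx y0 y *m block_mx 1%:M 0 0 (diag_mx d) *m (row_mx y0 y)^T) 0 0 =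
  y0 0 0 ^+ 2 + \sum_i d 0 i * y 0 i ^+ 2.
Proof.
rewrite mul_row_block !(mul0mx, mulmx0, mulmx1, addr0, add0r) tr_row_mx.
rewrite mul_row_col mxE; congr (_ + _).
  by rewrite mxE big_ord1 mxE.
rewrite mxE; apply: eq_bigr => i _.
by rewrite mul_mx_diag !mxE mulrAC mulrC.
Qed.

Hypothesis s_gt0 : forall i, 0 < s i.

(** In the coordinates [x *m L] the form is a sum of squares with positive weights 1 and [s i ^+ 2],
    and [L] is invertible. *)
Lemma factor_cov_posdef : posdefmx factor_cov.
Proof.
move=> x x0; rewrite covE.
have -> : x *m (L *m block_mx 1%:M 0 0 D *m L^T) *m x^T =
  (x *m L) *m block_mx 1%:M 0 0 D *m (x *m L)^T.
  by rewrite trmx_mul !mulmxA.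
have : x *m L != 0.
  apply: contra x0 => /eqP xL0; apply/eqP.
  by rewrite -[x]mulmx1 -LM mulmxA xL0 mul0mx.
rewrite -[x *m L]hsubmxK; move: (lsubmx (x *m L)) (rsubmx (x *m L)) => y0 y yN0.
rewrite quad_diag lt_neqAle; apply/andP; split; last first.
  rewrite addr_ge0 ?sqr_ge0// sumr_ge0// => i _.
  by rewrite mxE mulr_ge0 ?sqr_ge0.
apply: contra yN0; rewrite eq_sym paddr_eq0 ?sqr_ge0//; last first.
  by rewrite sumr_ge0// => i _; rewrite mxE mulr_ge0 ?sqr_ge0.
move=> /andP[y00 yi0]; apply/eqP.
have -> : y0 = 0.
  by apply/rowP => j; rewrite ord1 mxE; apply/eqP; rewrite -sqrf_eq0.
have -> : y = 0.
  apply/rowP => j; rewrite mxE; apply/eqP; move: yi0.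
  rewrite psumr_eq0; last by move=> i _; rewrite mxE mulr_ge0 ?sqr_ge0.
  move/allP/(_ j); rewrite mem_index_enum => /(_ isT).
  by rewrite mxE mulf_eq0 !sqrf_eq0 gt_eqF.
exact: row_mx0.
Qed.

Lemma factor_cov_correlation : (forall i, a i ^+ 2 + s i ^+ 2 = 1) ->
  correlation_mx factor_cov.
Proof.
move=> as1; split; first 2 last.
- move=> i; case: (@split_ordP 1 n i) => j ->.
    by rewrite [factor_cov _ _]block_mxEul mxE eqxx.
  rewrite [factor_cov _ _]block_mxEdr mxE [X in X + _]mxE big_ord1 !mxE eqxx -expr2.
  exact: as1.
- rewrite /factor_cov tr_block_mx trmx1 trmxK linearD/= trmx_mul trmxK.
  by rewrite tr_diag_mx.
- exact: factor_cov_posdef.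
Qed.

Let det_cov : \det factor_cov = \prod_i s i ^+ 2.
Proof.
rewrite covE !det_mulmx det_tr !det_lblock !det1 !mul1r mulr1 det_diag.
by apply: eq_bigr => i _; rewrite mxE.
Qed.

Let D' : 'M[R]_n := diag_mx (\row_i (s i ^+ 2)^-1).

Let inv_cov : invmx factor_cov = M^T *m block_mx 1%:M 0 0 D' *m M.
Proof.
set W := RHS; have SW : factor_cov *m W = 1%:M.
  rewrite covE /W -!mulmxA [L^T *m _]mulmxA -trmx_mul ML trmx1 mul1mx.
  rewrite [block_mx _ _ _ D *m _]mulmxA mulmx_block.
  rewrite !(mul0mx, mulmx0, mulmx1, mul1mx, addr0, add0r).
  have -> : D *m D' = 1%:M.
    rewrite /D /D' mulmx_diag; apply/matrixP => i j; rewrite !mxE.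
    by rewrite divff// sqrf_eq0 gt_eqF.
  by rewrite -scalar_mx_block mul1mx.
have /mulmx1_unit[uS _] := SW.
by rewrite -[LHS]mulmx1 -SW mulmxA mulVmx// mul1mx.
Qed.

(** Given Z = z the other coordinates are independent normals. Algebraically, [M] diagonalizes the
    inverse covariance and the determinant is the product of the [s i ^+ 2]. *)
Lemma factor_pdfE z t :
  mvnormal_pdf factor_mean factor_cov [tuple of z :: t] =
  normal_pdf 0 1 z * \prod_i normal_pdf (m i + a i * z) (s i) (tnth t i).
Proof.
rewrite /mvnormal_pdf det_cov inv_cov.
set x := _ - factor_mean.
have xE : x = row_mx (z%:M : 'rV[R]_1) (\row_i (tnth t i - m i)).
  apply/rowP => i; rewrite /x /factor_mean mxE [X in _ + X]mxE.
  case: (@split_ordP 1 n i) => j ->.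
    by rewrite !row_mxEl !mxE ord1 eqxx subr0 (tnth_nth 0).
  by rewrite !row_mxEr !mxE !(tnth_nth 0).
have -> : x *m (M^T *m block_mx 1%:M 0 0 D' *m M) *m x^T =
  (x *m M^T) *m block_mx 1%:M 0 0 D' *m (x *m M^T)^T.
  by rewrite trmx_mul trmxK !mulmxA.
have -> : x *m M^T = row_mx (z%:M : 'rV[R]_1) (\row_i (tnth t i - m i - a i * z)).
  rewrite xE /M tr_block_mx !trmx1 trmx0 mul_row_block !mulmx1 mulmx0 addr0.
  congr row_mx; rewrite linearN/= trmxK mulmxN mul_scalar_mx.
  by apply/rowP => i; rewrite !mxE addrC mulrC.
rewrite quad_diag mxE eqxx mulr1n normal_pdf01E.
transitivity ((Num.sqrt (pi *+ 2))^-1 * expR (- z ^+ 2 / 2) *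
   \prod_i (normal_peak (s i) * normal_fun (m i + a i * z) (s i) (tnth t i)));
  last first.
  by congr (_ * _); apply: eq_bigr => i _; rewrite normal_pdfE// gt_eqF.
rewrite [X in _ = _ * X]big_split/= [RHS]mulrACA; congr (_ * _).
  have pi2 : 0 <= pi *+ 2 :> R by rewrite mulrn_wge0// pi_ge0.
  rewrite exprS -mulrA sqrtrM// invfM; congr (_ * _).
  rewrite prodfV; congr (_^-1).
  have -> : (pi *+ 2) ^+ n = \prod_(i < n) (pi *+ 2) :> R.
    by rewrite prodr_const card_ord.
  rewrite -big_split/= sqrtr_prod; last first.
    by move=> i _; rewrite mulr_ge0 ?sqr_ge0.
  by apply: eq_bigr => i _; rewrite mulrC mulrnAr.
rewrite -expR_sum -expRD; congr expR.
rewrite opprD mulrDl; congr (_ + _).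
rewrite -sumrN mulr_suml; apply: eq_bigr => i _; rewrite !mxE.
by field; rewrite gt_eqF.
Qed.

End factor_model.

Lemma factor_mean0 {R : realType} {n : nat} (m : 'I_n -> R) :
  factor_mean m 0 ord0 = 0.
Proof.
have -> : ord0 = lshift n ord0 :> 'I_(1 + n) by exact: val_inj.
by rewrite [LHS]row_mxEl mxE.
Qed.

Lemma factor_meanS {R : realType} {n : nat} (m : 'I_n -> R) i :
  factor_mean m 0 (lift ord0 i) = m i.
Proof.
have -> : lift ord0 i = rshift 1 i :> 'I_(1 + n) by exact: val_inj.
by rewrite [LHS]row_mxEr mxE.
Qed.

(** * Integrals over tuples *)

Section lebesgue_tuple_integral.
Context {R : realType}.
Local Notation mu := (@lebesgue_measure R).
Local Notation T n := (n.-tuple (measurableTypeR R)).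

Lemma integral_lebesgue_tupleS n (f : T n.+1 -> \bar R) :
  measurable_fun [set: T n.+1] f -> (forall t, 0 <= f t)%E ->
  (\int[lebesgue_tuple R n.+1]_t f t =
   \int[mu]_x \int[lebesgue_tuple R n]_t f [tuple of x :: t])%E.
Proof.
move=> mf f0.
have mc : measurable_fun [set: measurableTypeR R * T n] (@tuple_cons R n).
  exact: measurable_tuple_cons.
transitivity (\int[pushforward (mu \x lebesgue_tuple R n)%E (@tuple_cons R n)]_t f t)%E.
  by [].
rewrite ge0_integral_pushforward//.
rewrite preimage_setT fubini_tonelli1//.
- exact: measurableT_comp.
- by move=> x; exact: f0.
Qed.

Lemma measurable_prod_tnth n (h : 'I_n -> R -> R) :
  (forall i, measurable_fun [set: R] (h i)) ->
  measurable_fun [set: T n] (fun t => \prod_i h i (tnth t i)).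
Proof.
move=> mh; apply: measurable_prod => i _.
exact: measurableT_comp (mh i) (@measurable_tnth _ (measurableTypeR R) n i).
Qed.

Lemma integral_lebesgue_tuple_prod n (h : 'I_n -> R -> R) (v : 'I_n -> R) :
  (forall i, measurable_fun [set: R] (h i)) -> (forall i x, 0 <= h i x) ->
  (forall i, \int[mu]_x (h i x)%:E = (v i)%:E)%E ->
  (\int[lebesgue_tuple R n]_t (\prod_i h i (tnth t i))%:E = (\prod_i v i)%:E)%E.
Proof.
elim: n h v => [|n IH] h v mh h0 hv.
  rewrite (eq_integral (cst 1%E)); last by move=> t _; rewrite big_ord0.
  rewrite big_ord0 integral_cst//= mul1e diracE.
  by rewrite mem_set.
rewrite integral_lebesgue_tupleS; last 2 first.
- by apply/measurable_EFinP; exact: measurable_prod_tnth.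
- by move=> t; rewrite lee_fin prodr_ge0.
transitivity (\int[mu]_x ((h ord0 x)%:E * (\prod_i v (lift ord0 i))%:E))%E.
  apply: eq_integral => x _.
  rewrite -(IH (fun i => h (lift ord0 i)))//.
  rewrite -ge0_integralZl//.
  - apply: eq_integral => t _; rewrite big_ord_recl EFinM tnth0; congr (_ * _%:E)%E.
    by apply: eq_bigr => i _; rewrite tnthS.
  - by apply/measurable_EFinP; exact: (@measurable_prod_tnth _ (fun i => h (lift ord0 i))).
  - by move=> t _; rewrite lee_fin prodr_ge0.
  - by rewrite lee_fin.
rewrite ge0_integralZr//=.
- by rewrite hv -EFinM -big_ord_recl.
- by apply/measurable_EFinP; exact: mh.
- by move=> x _; rewrite lee_fin.
- rewrite lee_fin prodr_ge0// => i _.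
  by rewrite -lee_fin -hv integral_ge0// => x _; rewrite lee_fin.
Qed.

(* Unlike [ge0_le_integral], the majorant f2 need not be measurable: the
   integral of a nonnegative function is a supremum over simple functions
   below it. *)
Lemma ge0_le_integral_nonmeasurable d (X : measurableType d)
    (nu : {measure set X -> \bar R}) (f1 f2 : X -> \bar R) :
  (forall x, 0 <= f1 x)%E -> (forall x, f1 x <= f2 x)%E ->
  (\int[nu]_x f1 x <= \int[nu]_x f2 x)%E.
Proof.
move=> f10 f12; have f20 x : (0 <= f2 x)%E by exact: le_trans (f12 x).
rewrite !ge0_integralTE//; apply: ereal_sup_le => _ [h hf1 <-].
by exists h => // x; exact: le_trans (f12 x).
Qed.

End lebesgue_tuple_integral.

(** * Functions that are products over the coordinates on each band of Z *)

Section banded_integral.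
Context {R : realType}.
Local Notation mu := (@lebesgue_measure R).
Local Notation T n := (n.-tuple (measurableTypeR R)).

(** Both the indicator of an event on one coordinate and a Chernoff weight have this form; the
    expectation is [al p + be (1 - p)], with [p] the probability of [B]. *)
Definition two_valued (al be : R) (B : set R) (x : R) : R :=
  al * \1_B x + be * \1_(~` B) x.

Lemma two_valued_ge0 al be B x : 0 <= al -> 0 <= be -> 0 <= two_valued al be B x.
Proof. by move=> al0 be0; rewrite addr_ge0// mulr_ge0. Qed.

Lemma measurable_two_valued al be (B : set R) : measurable B ->
  measurable_fun [set: R] (two_valued al be B).
Proof.
move=> mB; apply: measurable_funD; apply: measurable_funM => //.
by apply: measurable_indic; exact: measurableC.
Qed.

Lemma integral_scaled_indic m s (c : R) (E : set R) : 0 <= c -> measurable E ->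
  (\int[mu]_x (c * \1_E x * normal_pdf m s x)%:E =
   (c * fine (normal_prob m s E))%:E)%E.
Proof.
move=> c0 mE; rewrite EFinM fineK; last exact: fin_num_measure.
rewrite /normal_prob [in RHS]integral_mkcond -ge0_integralZl//.
- apply: eq_integral => x _; rewrite epatch_indic/= -!EFinM -mulrA.
  by rewrite [X in c * X]mulrC.
- apply/(measurable_restrictT _ mE); exact: measurable_EFin_normal_pdf.
- by move=> x _; apply: erestrict_ge0 => y _; rewrite lee_fin normal_pdf_ge0.
Qed.

Lemma integral_two_valued m s al be (B : set R) : 0 <= al -> 0 <= be ->
  measurable B ->
  (\int[mu]_x (two_valued al be B x * normal_pdf m s x)%:E =
   (al * fine (normal_prob m s B) + be * (1 - fine (normal_prob m s B)))%:E)%E.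
Proof.
move=> al0 be0 mB; have mCB : measurable (~` B) by exact: measurableC.
have -> : 1 - fine (normal_prob m s B) = fine (normal_prob m s (~` B)).
  by rewrite probability_setC// [RHS]fineB ?fin_num_measure.
rewrite EFinD -!integral_scaled_indic// -ge0_integralD//.
- by apply: eq_integral => x _; rewrite -EFinD -mulrDl.
- by move=> x _; rewrite lee_fin !mulr_ge0// normal_pdf_ge0.
- apply/measurable_EFinP; apply: measurable_funM; last exact: measurable_normal_pdf.
  by apply: measurable_funM => //; exact: measurable_indic.
- by move=> x _; rewrite lee_fin !mulr_ge0// normal_pdf_ge0.
- apply/measurable_EFinP; apply: measurable_funM; last exact: measurable_normal_pdf.
  by apply: measurable_funM => //; exact: measurable_indic.
Qed.

Context {n : nat} {J : finType}.
Variables (m a s : 'I_n -> R) (I : J -> set R) (B : J -> 'I_n -> set R).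
Hypothesis s_gt0 : forall i, 0 < s i.
Hypothesis mI : forall k, measurable (I k).
Hypothesis mB : forall k i, measurable (B k i).

Let p k i z := fine (normal_prob (m i + a i * z) (s i) (B k i)).

Definition banded (c : J -> R) (al be : J -> 'I_n -> R) (t : T n.+1) : R :=
  let z := tnth t ord0 in
  \sum_k c k * \1_(I k) z * normal_pdf 0 1 z *
    \prod_i (two_valued (al k i) (be k i) (B k i) (tnth t (lift ord0 i)) *
             normal_pdf (m i + a i * z) (s i) (tnth t (lift ord0 i))).

Lemma measurable_banded c al be : measurable_fun [set: T n.+1] (banded c al be).
Proof.
have mt i : measurable_fun [set: T n.+1] (fun t => tnth t i : R).
  exact: (@measurable_tnth _ (measurableTypeR R)).
apply: measurable_sum => k; apply: measurable_funM.
  apply: measurable_funM; last exact: (measurableT_comp (measurable_normal_pdf _ _) (mt _)).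
  apply: measurable_funM => //.
  have m1 : measurable_fun [set: R] (\1_(I k) : R -> R) by exact: measurable_indic.
  exact: (measurableT_comp m1 (mt ord0)).
apply: measurable_prod => i _; apply: measurable_funM.
  exact: (measurableT_comp (measurable_two_valued _ _ (mB k i)) (mt _)).
under eq_fun do rewrite normal_pdf_standardize//.
apply: measurable_funM => //.
apply: (measurableT_comp (measurable_normal_pdf 0 1)).
apply: measurable_funM => //; apply: measurable_funB => //.
by apply: measurable_funD => //; exact: measurable_funM.
Qed.

Lemma banded_ge0 c al be t : (forall k, 0 <= c k) ->
  (forall k i, 0 <= al k i) -> (forall k i, 0 <= be k i) -> 0 <= banded c al be t.
Proof.
move=> c0 al0 be0; apply: sumr_ge0 => k _.
rewrite !mulr_ge0 ?normal_pdf_ge0// prodr_ge0// => i _.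
by rewrite mulr_ge0 ?normal_pdf_ge0// two_valued_ge0.
Qed.

(** Once Z = z is fixed, the coordinates are independent and the product integrates factor by
    factor, which leaves an integral over z alone. *)
Lemma integral_banded c al be : (forall k, 0 <= c k) ->
  (forall k i, 0 <= al k i) -> (forall k i, 0 <= be k i) ->
  (\int[lebesgue_tuple R n.+1]_t (banded c al be t)%:E =
   \int[mu]_z (\sum_k c k * \1_(I k) z * normal_pdf 0 1 z *
     \prod_i (al k i * p k i z + be k i * (1 - p k i z)))%:E)%E.
Proof.
move=> c0 al0 be0; rewrite integral_lebesgue_tupleS; last 2 first.
- by apply/measurable_EFinP; exact: measurable_banded.
- by move=> t; rewrite lee_fin banded_ge0.
apply: eq_integral => z _; rewrite -sumEFin.
pose h k i x := two_valued (al k i) (be k i) (B k i) x *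
             normal_pdf (m i + a i * z) (s i) x.
have mh k i : measurable_fun [set: R] (h k i).
  apply: measurable_funM; last exact: measurable_normal_pdf.
  exact: measurable_two_valued.
have h0 k i x : 0 <= h k i x by rewrite mulr_ge0 ?two_valued_ge0 ?normal_pdf_ge0.
transitivity (\int[lebesgue_tuple R n]_t \sum_k
   ((c k * \1_(I k) z * normal_pdf 0 1 z)%:E * (\prod_i h k i (tnth t i))%:E))%E.
  apply: eq_integral => t _; rewrite /banded -sumEFin; apply: eq_bigr => k _.
  rewrite -EFinM tnth0; congr (_ * _)%:E; apply: eq_bigr => i _.
  by rewrite tnthS.
have c'0 k : 0 <= c k * \1_(I k) z * normal_pdf 0 1 z.
  by rewrite !mulr_ge0 ?normal_pdf_ge0.
rewrite ge0_integral_sum//=; last 2 first.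
- move=> k; apply/measurable_funeM/measurable_EFinP; exact: measurable_prod_tnth.
- by move=> k t _; rewrite -EFinM lee_fin mulr_ge0// prodr_ge0.
apply: eq_bigr => k _; rewrite ge0_integralZl//; last 3 first.
- apply/measurable_EFinP; exact: measurable_prod_tnth.
- by move=> t _; rewrite lee_fin prodr_ge0.
- by rewrite lee_fin.
rewrite (@integral_lebesgue_tuple_prod _ _ (h k)
  (fun i => al k i * p k i z + be k i * (1 - p k i z)))// => i.
exact: integral_two_valued.
Qed.

End banded_integral.

(** * From a pointwise bound on the FDP to a bound on the FDR *)

Section FDR_lower_bound.
Context {R : realType} {n : nat} {J : finType}.
Local Notation mu := (@lebesgue_measure R).
Local Notation T n := (n.-tuple (measurableTypeR R)).
Variables (q : R) (m a s : 'I_n -> R) (I : J -> set R) (B : J -> 'I_n -> set R).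
Hypothesis s_gt0 : forall i, 0 < s i.
Hypothesis mI : forall k, measurable (I k).
Hypothesis mB : forall k i, measurable (B k i).
Hypothesis disjI : forall k k' z, I k z -> I k' z -> k = k'.

Let p k i z := fine (normal_prob (m i + a i * z) (s i) (B k i)).

Lemma sum_indic_disjoint z : \sum_k \1_(I k) z <= 1 :> R.
Proof.
have [[k Ikz]|nI] := pselect (exists k, I k z).
  rewrite (bigD1 k)//= big1 ?addr0 => [|k' k'k].
    by rewrite indicE; case: (_ \in _).
  rewrite indicE memNset// => Ik'z; move/eqP: k'k; apply.
  exact: disjI Ik'z Ikz.
rewrite big1 ?ler01// => k _; rewrite indicE memNset// => Ikz.
by apply: nI; exists k.
Qed.

Lemma integral_sum_indic (c : J -> R) : (forall k, 0 <= c k) ->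
  (\int[mu]_z (\sum_k c k * \1_(I k) z * normal_pdf 0 1 z)%:E =
   (\sum_k c k * fine (normal_prob 0%R 1%R (I k)))%:E)%E.
Proof.
move=> c0; under eq_integral do rewrite -sumEFin.
rewrite ge0_integral_sum//=.
- by rewrite -sumEFin; apply: eq_bigr => k _; rewrite integral_scaled_indic.
- move=> k; apply/measurable_EFinP; apply: measurable_funM; last exact: measurable_normal_pdf.
  by apply: measurable_funM => //; apply: measurable_indic; exact: mI.
- by move=> k z _; rewrite lee_fin !mulr_ge0// normal_pdf_ge0.
Qed.

Let tuple_pdfE (t : T n.+1) :
  mvnormal_pdf (factor_mean m) (factor_cov a s) t =
  normal_pdf 0 1 (tnth t ord0) * \prod_i normal_pdf
    (m i + a i * tnth t ord0) (s i) (tnth t (lift ord0 i)).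
Proof.
rewrite {1}(tuple_eta t); rewrite [LHS]factor_pdfE//.
congr (_ * _); apply: eq_bigr => i _; congr normal_pdf.
by rewrite [in RHS](tuple_eta t) tnthS.
Qed.

Variables (f w : J -> R) (alA beA alC beC : J -> 'I_n -> R) (e : R).
Hypothesis f_ge0 : forall k, 0 <= f k.
Hypothesis w_ge0 : forall k, 0 <= w k.
Hypothesis alA_ge0 : forall k i, 0 <= alA k i.
Hypothesis beA_ge0 : forall k i, 0 <= beA k i.
Hypothesis alC_ge0 : forall k i, 0 <= alC k i.
Hypothesis beC_ge0 : forall k i, 0 <= beC k i.
Hypothesis e01 : 0 <= e <= 1.

(* A is the indicator of a favourable event for the non-nulls, C the Chernoff
   weight exp(lambda (c - count)), at least 1 when the null count is below c. *)
Hypothesis pointwise : forall k (t : T n.+1), I k (tnth t ord0) ->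
  f k * \prod_i two_valued (alA k i) (beA k i) (B k i) (tnth t (lift ord0 i)) <=
  FDP q (factor_mean m) (pvalues t) + f k * w k *
    \prod_i two_valued (alC k i) (beC k i) (B k i) (tnth t (lift ord0 i)).

Hypothesis mainA : forall k z, I k z ->
  1 - e <= \prod_i (alA k i * p k i z + beA k i * (1 - p k i z)).
Hypothesis mainC : forall k z, I k z ->
  w k * \prod_i (alC k i * p k i z + beC k i * (1 - p k i z)) <= e.

(* The difference of the two banded functions is a measurable minorant of the
   integrand of [FDR], so the measurability of [FDP] is never needed. *)
Lemma FDR_banded_ge :
  ((\sum_k f k * (1 - 2 * e) * fine (normal_prob 0%R 1%R (I k)))%:E <=
   FDR q (factor_mean m) (factor_cov a s))%E.
Proof.
case/andP: e01 => e0 e1.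
pose fw k := f k * w k.
have fw0 k : 0 <= fw k by exact: mulr_ge0.
pose A := banded m a s I B f alA beA.
pose C := banded m a s I B fw alC beC.
(* Truncation at 0 keeps the integrands nonnegative: [H] stays below the integrand of [FDR], and
   [A <= H + C] is integrated in place of a subtraction. *)
pose H t := Num.max 0 (A t - C t).
have pdf0 (t : T n.+1) : 0 <= mvnormal_pdf (factor_mean m) (factor_cov a s) t.
  rewrite tuple_pdfE mulr_ge0 ?normal_pdf_ge0// prodr_ge0// => i _.
  exact: normal_pdf_ge0.
have mA : measurable_fun setT A by exact: measurable_banded.
have mC : measurable_fun setT C by exact: measurable_banded.
have mH : measurable_fun setT H.
  by apply: measurable_maxr => //; exact: measurable_funB.
have A0 t : 0 <= A t by exact: banded_ge0.
have C0 t : 0 <= C t by exact: banded_ge0.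
have H0 t : 0 <= H t by rewrite le_max lexx.
have HFDR : (\int[lebesgue_tuple R n.+1]_t (H t)%:E <=
    FDR q (factor_mean m) (factor_cov a s))%E.
  apply: ge0_le_integral_nonmeasurable => t; rewrite lee_fin//.
  rewrite ge_max mulr_ge0 ?FDP_ge0//=.
  set z := tnth t ord0; set F := FDP _ _ _; set g := mvnormal_pdf _ _ t.
  have AE c al be : banded m a s I B c al be t =
      \sum_k \1_(I k) z * (c k *
       \prod_i two_valued (al k i) (be k i) (B k i) (tnth t (lift ord0 i))) * g.
    apply: eq_bigr => k _; rewrite big_split/= /g tuple_pdfE -/z.
    by rewrite -!mulrA mulrCA; congr (_ * (_ * _)); rewrite mulrCA.
  rewrite /A /C !AE -sumrB.
  (* At most one band contains [z], so summing the bandwise bounds gives at most [F * g]. *)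
  apply: (@le_trans _ _ (\sum_k \1_(I k) z * (F * g))).
    apply: ler_sum => k _; rewrite -mulrBl -mulrBr [leRHS]mulrA ler_wpM2r ?pdf0//.
    have [Ikz|nIkz] := pselect (I k z).
      by rewrite ler_wpM2l// lerBlDr; exact: pointwise.
    by rewrite indicE memNset// !mul0r.
  rewrite -mulr_suml -[leRHS]mul1r ler_wpM2r ?sum_indic_disjoint//.
  by rewrite mulr_ge0 ?FDP_ge0 ?pdf0.
have AHC : (\int[lebesgue_tuple R n.+1]_t (A t)%:E <=
    \int[lebesgue_tuple R n.+1]_t (H t)%:E +
    \int[lebesgue_tuple R n.+1]_t (C t)%:E)%E.
  rewrite -ge0_integralD//; first apply: ge0_le_integral_nonmeasurable => t.
  - by rewrite lee_fin.
  - by rewrite -EFinD lee_fin -lerBlDr le_max lexx orbT.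
  - by move=> t _; rewrite lee_fin.
  - exact/measurable_EFinP.
  - by move=> t _; rewrite lee_fin.
  - exact/measurable_EFinP.
have IA : ((\sum_k f k * (1 - e) * fine (normal_prob 0%R 1%R (I k)))%:E <=
    \int[lebesgue_tuple R n.+1]_t (A t)%:E)%E.
  rewrite integral_banded// -integral_sum_indic; last first.
    by move=> k; rewrite mulr_ge0// subr_ge0.
  apply: ge0_le_integral_nonmeasurable => z; rewrite lee_fin.
    by rewrite sumr_ge0// => k _; rewrite !mulr_ge0 ?subr_ge0 ?normal_pdf_ge0.
  apply: ler_sum => k _; have [Ikz|nIkz] := pselect (I k z).
    rewrite [leRHS]mulrC [f k * _]mulrC -!mulrA ler_wpM2r ?mainA//.
    by rewrite !mulr_ge0// normal_pdf_ge0.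
  by rewrite indicE memNset// !(mulr0, mul0r).
have IC : (\int[lebesgue_tuple R n.+1]_t (C t)%:E <=
    (\sum_k f k * e * fine (normal_prob 0%R 1%R (I k)))%:E)%E.
  rewrite integral_banded// -integral_sum_indic; last by move=> k; rewrite mulr_ge0.
  have p01 k i z : 0 <= p k i z <= 1.
    have mBki := mB k i; rewrite /p fine_ge0//= -lee_fin fineK ?fin_num_measure//.
    exact: probability_le1.
  apply: ge0_le_integral_nonmeasurable => z; rewrite lee_fin.
    rewrite sumr_ge0// => k _; rewrite !mulr_ge0 ?normal_pdf_ge0// prodr_ge0// => i _.
    have /andP[p0 p1] := p01 k i z.
    by rewrite addr_ge0// mulr_ge0// subr_ge0.
  apply: ler_sum => k _; have [Ikz|nIkz] := pselect (I k z).
    rewrite /fw -!mulrA ler_wpM2l// mulrCA [leRHS]mulrC -!mulrA.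
    rewrite ler_wpM2l// mulrCA ler_wpM2l ?normal_pdf_ge0//.
    exact: mainC.
  by rewrite indicE memNset// !(mulr0, mul0r).
apply: le_trans HFDR.
have -> : (\sum_k f k * (1 - 2 * e) * fine (normal_prob 0%R 1%R (I k)) =
  \sum_k f k * (1 - e) * fine (normal_prob 0%R 1%R (I k)) -
  \sum_k f k * e * fine (normal_prob 0%R 1%R (I k)))%R.
  by rewrite -sumrB; apply: eq_bigr => k _; ring.
rewrite EFinB leeBlDr//; apply: le_trans IA _; apply: le_trans AHC _.
by rewrite leeD2l.
Qed.

End FDR_lower_bound.

(** * Non-null groups and the null count *)

Section nonnull_groups.
Context {R : realType}.
Variables (q : R) (n K : nat) (M : nat -> nat) (t t' : nat -> R).
Hypothesis q_gt0 : 0 < q.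
Hypothesis M_anti : forall i j, (i <= j <= K)%N -> (M j <= M i)%N.
Hypothesis M0_le : (M 0 <= n)%N.
Variable m : 'I_n -> R.
Hypothesis m_gt0 : forall i : 'I_n, (i < M 0)%N -> 0 < m i.
Hypothesis m_eq0 : forall i : 'I_n, (M 0 <= i)%N -> m i = 0.

(* The non-nulls are the indices i < M 0, and M j of them are in a group of
   index at least j. *)
Definition group (i : nat) : nat := \max_(j < K.+1 | (i < M j)%N) j.

Lemma group_le i : (group i <= K)%N.
Proof. by apply/bigmax_leqP => j _; rewrite -ltnS. Qed.

(** Since [M] is nonincreasing, the [j] with [i < M j] form an initial segment, which contains 0
    when [i < M 0]. *)
Lemma leq_group i j : (i < M 0)%N -> (j <= K)%N -> (j <= group i)%N = (i < M j)%N.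
Proof.
move=> i0 jK; apply/idP/idP => [jg|ij]; last first.
  by rewrite -ltnS in jK; exact: (@leq_bigmax_cond _ _ _ (Ordinal jK)).
have /leq_trans -> // : (i < M (group i))%N.
  rewrite /group; elim/big_ind : _ => //.
  by move=> x y ix iy; rewrite /maxn; case: ifP.
by apply: M_anti; rewrite jg group_le.
Qed.

Lemma card_lift (P : pred 'I_n.+1) :
  #|[pred i | P i]| = (P ord0 + #|[pred i : 'I_n | P (lift ord0 i)]|)%N.
Proof.
rewrite -!sum1_card big_mkcond big_ord_recl/=; congr addn.
by rewrite [RHS]big_mkcond.
Qed.

Lemma card_ltn (x : nat) : (x <= n)%N -> #|[pred i : 'I_n | (i < x)%N]| = x.
Proof.
move=> xn; rewrite -sum1_card -(big_ord_widen_cond _ xpredT (fun=> 1%N) xn).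
by rewrite sum1_card card_ord.
Qed.

(** [FDP_ge] at [Phibar (t k)]. For a larger threshold [x], either every non-null with p-value at
    most [x] is in a group [>= k], and there are at most [M k] of them, or the lowest group [j < k]
    among them forces [x >= Phibar (t' j)], and there are at most [M j] of them. *)
Lemma group_FDP_ge k f (T : n.+1.-tuple R) : (k <= K)%N -> f <= 1 ->
  (forall i : 'I_n, (i < M 0)%N ->
    if (k <= group i)%N then t k <= tnth T (lift ord0 i)
    else tnth T (lift ord0 i) < t' (group i)) ->
  n.+1%:R * Phibar (t k) / q <= (M k)%:R +
    #|[pred i : 'I_n | (M 0 <= i)%N && (t k <= tnth T (lift ord0 i))%R]|%:R ->
  (M k)%:R <= (1 - f) * (n.+1%:R * Phibar (t k) / q) ->
  (forall j, (j < k)%N -> (M j)%:R <= (1 - f) * (n.+1%:R * Phibar (t' j) / q)) ->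
  f <= FDP q (factor_mean m) (pvalues T).
Proof.
move=> kK f1 hT hcnt hMk hMj.
have pT i : tnth (pvalues T) i = Phibar (tnth T i) by rewrite tnth_mktuple.
have MkM0 : (M k <= M 0)%N by exact: M_anti.
apply: (@FDP_ge _ _ _ _ _ (Phibar (t k))) => //; first exact: Phibar_gt0.
  apply: le_trans hcnt _; rewrite -natrD ler_nat card_lift.
  apply: leq_trans (leq_addl _ _).
  rewrite -{1}[M k]card_ltn ?(leq_trans MkM0)//.
  rewrite -(cardID [pred i : 'I_n | (i < M 0)%N]
    [pred i : 'I_n | tnth (pvalues T) (lift ord0 i) <= Phibar (t k)]).
  apply: leq_add; apply: subset_leq_card; apply/fintype.subsetP => i; rewrite !inE.
    move=> iMk; have iM0 := leq_trans iMk MkM0; rewrite iM0 andbT.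
    by move: (hT i iM0); rewrite leq_group// iMk pT => /Phibar_le.
  by rewrite pT -leqNgt => /andP[-> /Phibar_le ->].
move=> x tx.
set V := #|_|.
have VE : V = #|[pred i : 'I_n | (i < M 0)%N &&
    (Phibar (tnth T (lift ord0 i)) <= x)%R]|.
  rewrite /V card_lift !inE.
  (* The factor coordinate is itself a true null, so it drops out of the count of non-nulls. *)
  have -> : (factor_mean m 0 ord0 <= 0) = true.
    by rewrite factor_mean0 lexx.
  rewrite andbF add0n; apply: eq_card => i; rewrite !inE pT.
  rewrite factor_meanS andbC; congr (_ && _); case: ltnP => iM.
    by rewrite -ltNge m_gt0.
  by rewrite m_eq0// lexx.
have V_le j : (j <= K)%N -> (forall i : 'I_n, (i < M 0)%N ->
    Phibar (tnth T (lift ord0 i)) <= x -> (j <= group i)%N) -> (V <= M j)%N.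
  move=> jK jg; have MjM0 : (M j <= M 0)%N by exact: M_anti.
  rewrite VE -[leqRHS]card_ltn ?(leq_trans MjM0)//.
  apply: subset_leq_card; apply/fintype.subsetP => i; rewrite !inE.
  by move=> /andP[iM0 /(jg _ iM0)]; rewrite leq_group.
have f10 : 0 <= 1 - f by rewrite subr_ge0.
have scale y : y <= x -> (1 - f) * (n.+1%:R * y / q) <= (1 - f) * (n.+1%:R * x / q).
  by move=> yx; rewrite ler_wpM2l// ler_wpM2r ?invr_ge0 ?(ltW q_gt0)// ler_wpM2l.
pose bad (i : 'I_n) := [&& (i < M 0)%N, Phibar (tnth T (lift ord0 i)) <= x &
  (group i < k)%N].
have [/existsP[i0 hi0]|/existsPn none] := boolP [exists i, bad i].
  case: (@arg_minnP _ _ bad (fun i : 'I_n => group i) hi0) => i /and3P[iM0 ix ik] imin.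
  have := hT i iM0; rewrite leqNgt ik/= => /ltW/Phibar_le/le_trans/(_ ix)/scale.
  apply: le_trans; apply: le_trans (hMj _ ik); rewrite ler_nat.
  apply: V_le (group_le _) _ => i' i'M0 i'x.
  have [i'k|] := ltnP (group i') k; first by apply: imin; apply/and3P.
  by move/(leq_trans (ltnW ik)).
apply: le_trans (scale _ tx); apply: le_trans hMk; rewrite ler_nat.
apply: V_le kK _ => i iM0 ix; move: (none i).
by rewrite /bad iM0 ix/= -leqNgt.
Qed.

End nonnull_groups.

(** A union bound for independent events, through Bernoulli's inequality for [(1 - d) ^+ n]. *)
Lemma prod_ge_bernoulli {R : realDomainType} (n : nat) (d : R) (y : 'I_n -> R) :
  0 <= d <= 1 -> (forall i, 1 - d <= y i <= 1) -> 1 - n%:R * d <= \prod_i y i.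
Proof.
move=> /andP[d0 d1] hy.
apply: (@le_trans _ _ ((1 - d) ^+ n)).
  elim: n {y hy} => [|n IH]; first by rewrite mul0r subr0 expr0.
  have : (1 - n%:R * d) * (1 - d) <= (1 - d) ^+ n.+1.
    by rewrite exprSr ler_wpM2r// subr_ge0.
  apply: le_trans; rewrite -natr1.
  have : 0 <= n%:R * d * d by rewrite !mulr_ge0.
  by move=> h; nra.
rewrite -[X in _ ^+ X](card_ord n) -prodr_const; apply: ler_prod => i _.
by have /andP[-> _] := hy i; rewrite subr_ge0 d1.
Qed.

Lemma one_sub_expRN_ge {R : realType} (x : R) : 0 <= x -> x * (1 - x) <= 1 - expR (- x).
Proof.
move=> x0; have e1 := expR_ge1Dx x; have e0 := expR_gt0 (- x).
have : (1 + x) * expR (- x) <= 1.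
  by rewrite -[leRHS](expRxMexpNx_1 x) ler_wpM2r ?(ltW e0).
nra.
Qed.

(** Chernoff bound with parameter [e / 4] for a sum of [n0] trials of success probability at least
    [rho]: the level [N (1 - e) rho] lies below the mean, which is at least [N (1 - e / 2) rho]. *)
Lemma chernoff_lower {R : realType} (e N rho : R) (n0 : nat) :
  0 < e -> e <= 1 -> 0 <= N -> 0 <= rho -> N * (1 - e / 2) <= n0%:R ->
  16 <= N * rho * e ^+ 3 ->
  expR (e / 4 * (N * (1 - e) * rho)) *
  expR (- (rho * (1 - expR (- (e / 4))))) ^+ n0 <= e.
Proof.
move=> e0 e1 N0 rho0 n0N hN; rewrite -expRM_natl -expRD.
set y := _ + _; have yE : y <= - (N * rho * e ^+ 2 / 16).
  have g_ge : e / 4 * (1 - e / 4) <= 1 - expR (- (e / 4)).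
    by apply: one_sub_expRN_ge; lra.
  rewrite /y; move: (1 - expR _) g_ge => g g_ge.
  have h1 : N * (1 - e / 2) * (rho * (e / 4 * (1 - e / 4))) <= n0%:R * (rho * g).
    apply: ler_pM => //; [apply: mulr_ge0; lra| |exact: ler_wpM2l].
    by rewrite mulr_ge0// mulr_ge0; lra.
  have h2 : 0 <= N * rho * e ^+ 3 by rewrite mulr_ge0 ?exprn_ge0 ?(ltW e0)// mulr_ge0.
  rewrite mulrN; apply: (@le_trans _ _ (e / 4 * (N * (1 - e) * rho) -
    N * (1 - e / 2) * (rho * (e / 4 * (1 - e / 4))))); first lra.
  rewrite -subr_ge0 (_ : _ - _ = N * rho * e ^+ 3 / 32); last by field.
  by rewrite divr_ge0.
(* The exponent is at most [- 1 / e] because [16 <= N rho e ^+ 3], and [exp (1 / e) >= 1 / e]. *)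
apply: (@le_trans _ _ (expR (- e^-1))).
  rewrite ler_expR (le_trans yE)// lerN2 -div1r ler_pdivrMr//.
  by rewrite (_ : _ * e = N * rho * e ^+ 3 / 16); [lra|field].
rewrite expRN invf_ple ?posrE ?expR_gt0//.
by apply: le_trans (expR_ge1Dx _); lra.
Qed.

(** * The construction on bands *)

(* On the band ]l k, u k[ of values of Z the BH threshold t k is reached and the
   FDP is at least about f k. The nulls have loading a; the non-nulls have
   loading -c close to -1 and residual standard deviation sigma, which is chosen
   after n so small that no residual matters. *)
Section band_design.
Context {R : realType}.
Variables (q e eta a sigma : R) (K n : nat) (l u t f : nat -> R).
Hypotheses (q_gt0 : 0 < q) (e_gt0 : 0 < e) (e_le1 : e <= 1) (eta_gt0 : 0 < eta).
Hypotheses (a_gt0 : 0 < a) (a_lt1 : a < 1).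
Hypothesis gap : forall j k, (j < k <= K)%N -> u j + eta <= l k.
Hypothesis u_mono : forall j k, (j <= k <= K)%N -> u j <= u k.
Hypothesis u_gt0 : forall k, (k <= K)%N -> 0 < u k.
Hypothesis t_mono : forall j k, (j <= k <= K)%N -> t j <= t k.
Hypothesis t0_gt0 : 0 < t 0%N.
Hypothesis f_mono : forall j k, (j <= k <= K)%N -> f j <= f k.
Hypothesis f0_gt0 : 0 < f 0%N.
Hypothesis f_le1 : forall k, (k <= K)%N -> f k <= 1.
Hypothesis tail_ratio : forall k, (k <= K)%N ->
  2 * Phibar (t k) <= e * Phibar (t k - eta / 4).
Hypothesis null_rate : forall k z, (k <= K)%N -> l k < z -> z < u k ->
  f k * Phibar (t k) <= q * Phibar ((t k - a * z) / Num.sqrt (1 - a ^+ 2)).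
Hypothesis tail0 : Phibar (t 0%N) <= q * e / 4.
Let N : R := n.+1%:R.
Hypothesis N_ge1 : 1 <= e * (N * Phibar (t K) / q).
Hypothesis N_ge2 : 8 <= N * e.
Hypothesis N_ge3 : 16 <= N * (f 0%N * Phibar (t K) / q) * e ^+ 3.
Hypotheses (sigma_gt0 : 0 < sigma) (sigma_le : sigma <= 1 / 2).
Hypothesis sigma_small : N * Phibar (eta / 8 / sigma) <= e.

Let N_gt0 : 0 < N. Proof. by rewrite ltr0n. Qed.

(** BH reaches the threshold [t k] with [N Phibar (t k) / q] rejections. With high probability the
    nulls supply the fraction [F k] of them; [x k] is the remainder left to the non-nulls and [M k]
    an integer just above it. *)
Let F k := f k * (1 - e).
Let x k := N * ((1 - F k) * Phibar (t k) / q).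
Let M k := (Num.truncn (x k)).+1.
Let c : R := Num.sqrt (1 - sigma ^+ 2).
Let s0 : R := Num.sqrt (1 - a ^+ 2).
Let g (i : nat) := group K M i.

Let f_gt0 k : (k <= K)%N -> 0 < f k.
Proof. by move=> kK; apply: (lt_le_trans f0_gt0); apply: f_mono. Qed.

Let F_ge0 k : (k <= K)%N -> 0 <= F k.
Proof. by move=> kK; rewrite mulr_ge0 ?subr_ge0// ltW// f_gt0. Qed.

Let F_le1 k : (k <= K)%N -> F k <= 1.
Proof.
move=> kK; have := f_le1 kK; have := mulr_gt0 (f_gt0 kK) e_gt0.
by rewrite /F => h1 h2; lra.
Qed.

Let x_ge0 k : (k <= K)%N -> 0 <= x k.
Proof.
move=> kK; rewrite mulr_ge0 ?(ltW N_gt0)// divr_ge0 ?(ltW q_gt0)//.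
by rewrite mulr_ge0 ?Phibar_ge0// subr_ge0 F_le1.
Qed.

Let M_bounds k : (k <= K)%N -> x k <= (M k)%:R <= x k + 1.
Proof.
move=> kK; rewrite /M ltW ?truncnS_gt//= -natr1 lerD2r truncn_le.
exact: x_ge0.
Qed.

Let M_anti i j : (i <= j <= K)%N -> (M j <= M i)%N.
Proof.
move=> ijK; have /andP[ij jK] := ijK; have iK := leq_trans ij jK.
rewrite ltnS le_truncn// ler_wpM2l ?(ltW N_gt0)// ler_wpM2r ?invr_ge0 ?(ltW q_gt0)//.
rewrite ler_pM ?Phibar_ge0 ?subr_ge0 ?F_le1 ?Phibar_le ?t_mono//.
by rewrite lerD2l lerN2 ler_wpM2r ?f_mono// subr_ge0.
Qed.

Let Phibar_tK k : (k <= K)%N -> Phibar (t K) <= Phibar (t k).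
Proof. by move=> kK; apply/Phibar_le/t_mono; rewrite kK leqnn. Qed.

Let NPk_ge k : (k <= K)%N -> 1 <= e * (N * Phibar (t k) / q).
Proof.
move=> kK; apply: le_trans N_ge1 _; rewrite ler_wpM2l ?(ltW e_gt0)//.
by rewrite ler_wpM2r ?invr_ge0 ?(ltW q_gt0)// ler_wpM2l ?(ltW N_gt0)// Phibar_tK.
Qed.

(** [tail0] gives [x 0 <= N e / 4], and [8 <= N e] absorbs two units: one for rounding [x 0] up, one
    for the factor coordinate, as [N = n + 1]. *)
Let M0_small : (M 0)%:R + 1 <= N * (e / 2).
Proof.
have /andP[_ M0] := @M_bounds 0%N isT.
have x0 : x 0%N <= N * (e / 4).
  rewrite ler_wpM2l ?(ltW N_gt0)// ler_pdivrMr//.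
  have := mulr_ge0 (F_ge0 (leq0n K)) (Phibar_ge0 (t 0%N)).
  by have := tail0; lra.
have lin (N' y m : R) : 8 <= N' * e -> y <= N' * (e / 4) -> m <= y + 1 ->
  m + 1 <= N' * (e / 2) by lra.
exact: lin N_ge2 x0 M0.
Qed.

Let M0_le : (M 0 <= n)%N.
Proof.
rewrite -ltnS -(ltr_nat R) -/N; have := M0_small; have : 0 < N * (1 - e / 2).
  by apply: mulr_gt0 N_gt0 _; have := e_le1; lra.
have lin (N' y : R) : 0 < N' * (1 - e / 2) -> y + 1 <= N' * (e / 2) -> y < N' by lra.
exact: lin.
Qed.

Let null_count : N * (1 - e / 2) <= (n - M 0)%:R.
Proof.
have lin (y m : R) : m + 1 <= (y + 1) * (e / 2) -> (y + 1) * (1 - e / 2) <= y - m.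
  by lra.
rewrite [leRHS](natrB _ M0_le) /N -(natr1 n); apply: lin.
by rewrite (natr1 n); exact: M0_small.
Qed.

(** Given Z = z, a non-null of group [j] has mean [t j + c (u j - z) + eta / 8]. This is at least
    [t j + eta / 8] for [z <= u j]; for [z >= u j + eta], since [c >= 1 / 2], it is at most
    [t j - 3 eta / 8], which is [eta / 8] below the cutoff [t j - eta / 4]. *)
Let mean (i : 'I_n) : R :=
  if (i < M 0)%N then t (g i) + c * u (g i) + eta / 8 else 0.
Let load (i : 'I_n) : R := if (i < M 0)%N then - c else a.
Let sd (i : 'I_n) : R := if (i < M 0)%N then sigma else s0.
(** For a non-null this is the side of its cutoff that is wanted on band [k]; for a null it is the
    event of reaching [t k], whose occurrences are counted. *)
Let good (k : 'I_K.+1) (i : 'I_n) : set R :=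
  if (i < M 0)%N && (g i < k)%N then `]-oo, (t (g i) - eta / 4)[%classic
  else `[t k, +oo[%classic.

Let c_ge : 1 / 2 <= c.
Proof.
have h : (1 / 2) ^+ 2 <= 1 - sigma ^+ 2.
  by have := sigma_gt0; have := sigma_le; nra.
rewrite -[1 / 2]ger0_norm ?divr_ge0// -sqrtr_sqr ler_sqrt//.
by apply: le_trans h; exact: sqr_ge0.
Qed.

Let s0_gt0 : 0 < s0.
Proof. by rewrite sqrtr_gt0; have := a_gt0; have := a_lt1; nra. Qed.

Let sd_gt0 i : 0 < sd i.
Proof. by rewrite /sd; case: ifP. Qed.

Let load_sd i : load i ^+ 2 + sd i ^+ 2 = 1.
Proof.
have hs : 0 <= 1 - sigma ^+ 2 by have := sigma_gt0; have := sigma_le; nra.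
have ha : 0 <= 1 - a ^+ 2 by have := a_gt0; have := a_lt1; nra.
by rewrite /load /sd; case: ifP => _; rewrite ?sqrrN sqr_sqrtr//; ring.
Qed.

Let mean_gt0 (i : 'I_n) : (i < M 0)%N -> 0 < mean i.
Proof.
move=> iM; rewrite /mean iM; have gK : (g i <= K)%N by exact: group_le.
have := u_gt0 gK; have := c_ge; have : t 0%N <= t (g i) by exact: t_mono.
move=> h1 h2 h3; have := t0_gt0; have := eta_gt0.
by nra.
Qed.

Let mean_eq0 (i : 'I_n) : (M 0 <= i)%N -> mean i = 0.
Proof. by move=> iM; rewrite /mean ltnNge iM. Qed.

Let mgood k i : measurable (good k i).
Proof. by rewrite /good; case: ifP. Qed.

Let band (k : 'I_K.+1) : set R := `]l k, u k[%classic.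

Let kK (k : 'I_K.+1) : (k <= K)%N. Proof. by rewrite -ltnS. Qed.

Let band_disjoint k k' z : band k z -> band k' z -> k = k'.
Proof.
rewrite /band/= !in_itv/= => /andP[lk uk] /andP[lk' uk'].
apply: val_inj; case: (ltngtP k k') => //= kk; exfalso.
- have : u k + eta <= l k' by apply: gap; rewrite kk kK.
  by have := eta_gt0; lra.
- have : u k' + eta <= l k by apply: gap; rewrite kk kK.
  by have := eta_gt0; lra.
Qed.

Let p k i z := fine (normal_prob (mean i + load i * z) (sd i) (good k i)).

Let p_itvcy (m s y : R) : 0 < s -> fine (normal_prob m s `[y, +oo[) = Phibar ((y - m) / s).
Proof. by move=> s_gt0; rewrite normal_prob_itvcy. Qed.

Let p_itvNyo (m s y : R) : 0 < s ->
  fine (normal_prob m s `]-oo, y[) = 1 - Phibar ((y - m) / s).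
Proof.
move=> s_gt0; rewrite -setCitvr probability_setC// [LHS]fineB ?fin_num_measure//.
by rewrite [X in _ - X]p_itvcy.
Qed.

Let p01 k i z : 0 <= p k i z <= 1.
Proof.
rewrite /p /good; case: ifP => _.
  by rewrite p_itvNyo// subr_ge0 Phibar_le1 lerBlDr lerDl Phibar_ge0.
by rewrite p_itvcy// Phibar_ge0 Phibar_le1.
Qed.

(** On either side the conditional mean is [eta / 8] away from the boundary of [good]: [gap] places
    [z] above [u (g i) + eta] if [g i < k], and [u_mono] places it below [u (g i)] otherwise. *)
Let p_nonnull (k : 'I_K.+1) (i : 'I_n) z : band k z -> (i < M 0)%N ->
  1 - Phibar (eta / 8 / sigma) <= p k i z.
Proof.
rewrite /band/= in_itv/= => /andP[lz zu] iM.
have gK : (g i <= K)%N by exact: group_le.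
have si0 : 0 < sigma^-1 by rewrite invr_gt0.
have cge := c_ge.
rewrite /p /good iM/= /mean /load /sd iM; case: ltnP => gk.
  rewrite p_itvNyo// lerB// Phibar_le// ler_wpM2r ?(ltW si0)//.
  have : u (g i) + eta <= l k by apply: gap; rewrite gk kK.
  by have := eta_gt0; nra.
rewrite p_itvcy// -PhibarN Phibar_le// -mulNr ler_wpM2r ?(ltW si0)//.
have : t k <= t (g i) by apply: t_mono; rewrite gk.
have : u k <= u (g i) by apply: u_mono; rewrite gk.
by have := eta_gt0; nra.
Qed.

Let p_null (k : 'I_K.+1) (i : 'I_n) z : band k z -> (M 0 <= i)%N ->
  f k * Phibar (t k) / q <= p k i z.
Proof.
rewrite /band/= in_itv/= => /andP[lz zu] iM.
rewrite /p /good /mean /load /sd ltnNge iM/= p_itvcy// add0r ler_pdivrMr// mulrC.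
by rewrite [leRHS]mulrC mulrC null_rate.
Qed.

Let lam : R := e / 4.
Let lam_gt0 : 0 < lam. Proof. by rewrite divr_gt0. Qed.
Let rho (k : nat) : R := f k * Phibar (t k) / q.
Let w (k : 'I_K.+1) : R := expR (lam * (N * (1 - e) * rho k)).
(** The loss [e] pays for the rounding in [M k] and for the groups below [k]; the maximum with 0
    keeps the weight nonnegative. *)
Let f' (k : 'I_K.+1) : R := Num.max 0 (F k - e).
(** Paired with the value 1 on [good], [beA] yields the indicator that all non-nulls are good.
    Paired with the value 1 off [good], [alC] yields [exp (- lam)] to the number of nulls reaching
    [t k]. *)
Let beA (k : 'I_K.+1) (i : 'I_n) : R := if (i < M 0)%N then 0 else 1.
Let alC (k : 'I_K.+1) (i : 'I_n) : R := if (i < M 0)%N then 1 else expR (- lam).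

Let beA_ge0 k i : 0 <= beA k i.
Proof. by rewrite /beA; case: ifP. Qed.

Let alC_ge0 k i : 0 <= alC k i.
Proof. by rewrite /alC; case: ifP => // _; exact: expR_ge0. Qed.

Let f'_ge0 k : 0 <= f' k.
Proof. by rewrite le_max lexx. Qed.

Let good_FDP (k : 'I_K.+1) (T : n.+1.-tuple R) :
  (forall i : 'I_n, (i < M 0)%N -> good k i (tnth T (lift ord0 i))) ->
  N * (1 - e) * rho k <=
    #|[pred i : 'I_n | (M 0 <= i)%N && (t k <= tnth T (lift ord0 i))]|%:R ->
  f' k <= FDP q (factor_mean mean) (pvalues T).
Proof.
move=> hgood hcnt; rewrite ge_max FDP_ge0/=.
have NqP y : 0 <= y -> 0 <= N * y / q.
  by move=> y0; rewrite divr_ge0 ?(ltW q_gt0)// mulr_ge0 ?(ltW N_gt0).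
have F1 := F_le1 (kK k); have F0 := F_ge0 (kK k).
apply: (@group_FDP_ge _ q n K M t (fun j => t j - eta / 4) _ _ _ _ _ _ k) => //.
- by have := e_gt0; lra.
- move=> i iM; have := hgood _ iM; rewrite /good iM/= -/(g i).
  by case: ltnP => _ /=; rewrite in_itv/= ?andbT.
- rewrite -/N; have /andP[xM _] := M_bounds (kK k).
  have -> : N * Phibar (t k) / q = x k + N * (1 - e) * rho k.
    by rewrite /x /rho /F; field; rewrite gt_eqF// q_gt0.
  by rewrite lerD.
- rewrite -/N; have /andP[_ Mx] := M_bounds (kK k).
  apply: le_trans Mx _; have := NPk_ge (kK k).
  have -> : x k = (1 - F k) * (N * Phibar (t k) / q) by rewrite /x; ring.
  by move=> h; lra.
(* Here [M j] is at most [2 N Phibar (t j) / q], and by [tail_ratio] the threshold lowered by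
   [eta / 4] makes this at most [e N Phibar (t j - eta / 4) / q]. *)
- move=> j jk; have jK : (j <= K)%N by exact: leq_trans (ltnW jk) (kK k).
  rewrite -/N; have /andP[_ Mx] := M_bounds jK.
  apply: le_trans Mx _; have NP1 := NPk_ge jK.
  have -> : x j = (1 - F j) * (N * Phibar (t j) / q) by rewrite /x; ring.
  have FN := mulr_ge0 (F_ge0 jK) (NqP _ (Phibar_ge0 (t j))).
  have eN : e * (N * Phibar (t j) / q) <= N * Phibar (t j) / q.
    by rewrite ler_piMl// NqP// Phibar_ge0.
  have := NqP _ (Phibar_ge0 (t j - eta / 4)) => /(mulr_ge0 _) P'0.
  have P'1 : 0 <= (1 - F k) * (N * Phibar (t j - eta / 4) / q).
    by apply: P'0; rewrite subr_ge0.
  have tr : N * (2 * Phibar (t j)) / q <= N * (e * Phibar (t j - eta / 4)) / q.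
    rewrite ler_wpM2r ?invr_ge0 ?(ltW q_gt0)// ler_wpM2l ?(ltW N_gt0)//.
    exact: tail_ratio.
  have -> : (1 - (F k - e)) * (N * Phibar (t j - eta / 4) / q) =
    (1 - F k) * (N * Phibar (t j - eta / 4) / q) +
    N * (e * Phibar (t j - eta / 4)) / q by ring.
  have : N * (2 * Phibar (t j)) / q = 2 * (N * Phibar (t j) / q) by ring.
  by move=> h; lra.
Qed.

Let two_valuedE (al be : R) B y :
  two_valued al be B y = if y \in B then al else be.
Proof.
rewrite /two_valued !indicE in_setC.
by case: (y \in B); rewrite /= !(mulr1, mulr0, addr0, add0r).
Qed.

(** Three cases: a misplaced non-null makes the left side 0; if all are good and the null count is
    large, [good_FDP] applies; if the null count is small, the Chernoff weight is at least 1. *)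
Let pointwise (k : 'I_K.+1) (T : n.+1.-tuple (measurableTypeR R)) :
  band k (tnth T ord0) ->
  f' k * \prod_i two_valued 1 (beA k i) (good k i) (tnth T (lift ord0 i)) <=
  FDP q (factor_mean mean) (pvalues T) + f' k * w k *
    \prod_i two_valued (alC k i) 1 (good k i) (tnth T (lift ord0 i)).
Proof.
move=> _; set PA := \prod_i _; set PC := \prod_i _.
have PC0 : 0 <= PC.
  by apply: prodr_ge0 => i _; rewrite two_valuedE; case: ifP.
have w0 : 0 <= w k by exact: expR_ge0.
have RHS0 : 0 <= f' k * w k * PC by rewrite !mulr_ge0.
have FDP0 := FDP_ge0 q (factor_mean mean) (pvalues T).
have [[i [iM igood]]|all_good] := pselect (exists i : 'I_n,
    (i < M 0)%N /\ ~ good k i (tnth T (lift ord0 i))).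
  rewrite /PA (bigD1 i)//= two_valuedE memNset// /beA iM mul0r mulr0.
  exact: addr_ge0.
have {}all_good (i : 'I_n) : (i < M 0)%N -> good k i (tnth T (lift ord0 i)).
  by move=> iM; apply: contrapT => ng; apply: all_good; exists i.
have PA1 : f' k * PA <= f' k.
  rewrite ler_piMr//; apply: prodr_ile1 => i _; rewrite two_valuedE /beA.
  by case: ifP => _; [rewrite ler01 lexx|case: ifP => _; rewrite ?ler01 ?lexx].
apply: le_trans PA1 _.
set cnt := #|[pred i : 'I_n | (M 0 <= i)%N && (t k <= tnth T (lift ord0 i))]|.
have [cntN|cntN] := leP (N * (1 - e) * rho k) cnt%:R.
  by apply: le_trans (good_FDP all_good cntN) _; rewrite lerDl.
apply: (@le_trans _ _ (f' k * w k * PC)); last by rewrite lerDr.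
rewrite -mulrA ler_peMr//.
have -> : PC = expR (- lam) ^+ cnt.
  rewrite /cnt -prodr_const big_mkcond/=; apply: eq_bigr => i _.
  rewrite two_valuedE /alC inE/=; case: ltnP => iM /=.
    by case: ifP.
  rewrite /good ltnNge iM/= mem_setE in_itv/= andbT.
  by [].
rewrite -expRM_natl -expRD -[leLHS]expR0 ler_expR mulrN subr_ge0 mulrC.
by apply: ler_wpM2l; exact: ltW.
Qed.

Let mainA k z : band k z ->
  1 - e <= \prod_i (1 * p k i z + beA k i * (1 - p k i z)).
Proof.
move=> kz; set d := Phibar (eta / 8 / sigma).
have d0 : 0 <= d by exact: Phibar_ge0.
apply: (@le_trans _ _ (1 - n%:R * d)).
  have := sigma_small; rewrite -/d /N -natr1 mulrDl mul1r.
  by move: (n%:R * d) d0 => y d0 h; lra.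
apply: prod_ge_bernoulli => [|i]; first by rewrite d0 Phibar_le1.
rewrite /beA mul1r; case: ltnP => iM.
  by rewrite mul0r addr0 p_nonnull//=; have /andP[] := p01 k i z.
by rewrite mul1r addrCA subrr addr0 lexx andbT lerBlDr lerDl.
Qed.

(** Each null contributes a factor [1 - p (1 - exp (- lam)) <= exp (- y)], each non-null a factor 1,
    and [null_count] feeds [chernoff_lower]. *)
Let mainC k z : band k z ->
  w k * \prod_i (alC k i * p k i z + 1 * (1 - p k i z)) <= e.
Proof.
move=> kz; set y := rho k * (1 - expR (- lam)).
have rho0 : 0 <= rho k.
  rewrite divr_ge0 ?(ltW q_gt0)// mulr_ge0 ?Phibar_ge0//.
  by rewrite ltW// f_gt0.
have elam : 0 <= 1 - expR (- lam) by rewrite subr_ge0 expR_le1 oppr_le0 (ltW lam_gt0).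
have prod_le : \prod_i (alC k i * p k i z + 1 * (1 - p k i z)) <=
    expR (- y) ^+ (n - M 0).
  have -> : (n - M 0)%N = #|[pred i : 'I_n | (M 0 <= i)%N]|.
    rewrite -[X in (X - _)%N](card_ord n) -(cardC [pred i : 'I_n | (i < M 0)%N]).
    rewrite card_ltn// addKn; apply: eq_card => i; rewrite !inE.
    by rewrite -leqNgt.
  rewrite -prodr_const [leRHS]big_mkcond/=; apply: ler_prod => i _.
  have /andP[p0 p1] := p01 k i z.
  rewrite addr_ge0 ?mulr_ge0 ?subr_ge0//= inE /alC.
  case: ltnP => iM; first by rewrite !mul1r addrCA subrr addr0.
  apply: (@le_trans _ _ (1 + - (p k i z * (1 - expR (- lam))))); first lra.
  apply: le_trans (expR_ge1Dx _) _; rewrite ler_expR lerN2 ler_wpM2r//.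
  exact: p_null.
apply: (@le_trans _ _ (w k * expR (- y) ^+ (n - M 0))).
  by rewrite ler_wpM2l ?expR_ge0.
apply: chernoff_lower => //.
apply: le_trans N_ge3 _; rewrite ler_wpM2r ?exprn_ge0 ?(ltW e_gt0)//.
rewrite ler_wpM2l ?(ltW N_gt0)// ler_wpM2r ?invr_ge0 ?(ltW q_gt0)//.
rewrite ler_pM ?Phibar_ge0 ?(ltW f0_gt0) ?Phibar_tK ?kK//.
by apply: f_mono; rewrite kK.
Qed.

Lemma band_design : exists (theta : 'rV[R]_n.+1) (S : 'M[R]_n.+1),
  [/\ correlation_mx S,
    ((\sum_(k < K.+1) (f k - 4 * e) *
       fine (normal_prob 0%R 1%R `]l k, u k[%classic))%:E <= FDR q theta S)%E,
    forall i, i \in true_null theta -> theta 0 i = 0 &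
    forall i, i \notin true_null theta -> 0 < theta 0 i].
Proof.
exists (factor_mean mean), (factor_cov load sd); split.
- exact: factor_cov_correlation.
- have e01 : 0 <= e <= 1 by rewrite ltW.
  have w0 k : 0 <= w k by exact: expR_ge0.
  have := @FDR_banded_ge R n 'I_K.+1 q mean load sd band good sd_gt0
    (fun k => measurable_itv _) mgood band_disjoint f' w (fun _ _ => 1) beA alC
    (fun _ _ => 1) e f'_ge0 w0 (fun _ _ => ler01) beA_ge0 alC_ge0
    (fun _ _ => ler01) e01 pointwise mainA mainC.
  apply: le_trans; rewrite lee_fin; apply: ler_sum => k _.
  apply: ler_wpM2r; first exact: fine_ge0.
  (* The loss [4 e] is made of [e] from [F], [e] from [f'], and [2 e f' <= 2 e] from
     [FDR_banded_ge]. *)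
  have F1 := F_le1 (kK k).
  have f'1 : f' k <= 1 by rewrite ge_max ler01; have := e_gt0; lra.
  have ff' : F k - e <= f' k by rewrite le_max lexx orbT.
  have := mulr_ge0 (ltW e_gt0) (f'_ge0 k); have := f_le1 (kK k).
  move: ff' f'1; rewrite /F; move: (f' k) (f k) => x1 x2 h1 h2 h3 h4.
  have := e_gt0; have := e_le1.
  nra.
- move=> i; rewrite inE; case: (unliftP ord0 i) => [j ->|->]; last first.
    by rewrite factor_mean0.
  rewrite factor_meanS; have [jM|jM] := ltnP j (M 0); last by rewrite mean_eq0.
  by rewrite leNgt mean_gt0.
- move=> i; rewrite inE; case: (unliftP ord0 i) => [j ->|->]; last first.
    by rewrite factor_mean0 lexx.
  rewrite factor_meanS; have [jM|jM] := ltnP j (M 0); first by rewrite mean_gt0.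
  by rewrite mean_eq0// lexx.
Qed.

End band_design.

(** * Choice of the parameters *)

Lemma expRN_le_inv {R : realType} (x : R) : 0 < x -> expR (- x) <= x^-1.
Proof.
move=> x0; rewrite expRN lef_pV2 ?posrE ?expR_gt0//.
by apply: le_trans (expR_ge1Dx x); rewrite lerDr.
Qed.

Lemma band_design_large {R : realType} (q e eta a : R) (K : nat) (l u t f : nat -> R) :
  0 < q -> 0 < e -> e <= 1 -> 0 < eta -> 0 < a -> a < 1 ->
  (forall j k, (j < k <= K)%N -> u j + eta <= l k) ->
  (forall j k, (j <= k <= K)%N -> u j <= u k) ->
  (forall k, (k <= K)%N -> 0 < u k) ->
  (forall j k, (j <= k <= K)%N -> t j <= t k) ->
  0 < t 0%N ->
  (forall j k, (j <= k <= K)%N -> f j <= f k) ->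
  0 < f 0%N ->
  (forall k, (k <= K)%N -> f k <= 1) ->
  (forall k, (k <= K)%N -> 2 * Phibar (t k) <= e * Phibar (t k - eta / 4)) ->
  (forall k z, (k <= K)%N -> l k < z -> z < u k ->
    f k * Phibar (t k) <= q * Phibar ((t k - a * z) / Num.sqrt (1 - a ^+ 2))) ->
  Phibar (t 0%N) <= q * e / 4 ->
  exists (n : nat) (theta : 'rV[R]_n.+1) (S : 'M[R]_n.+1),
  [/\ correlation_mx S,
    ((\sum_(k < K.+1) (f k - 4 * e) *
       fine (normal_prob 0%R 1%R `]l k, u k[%classic))%:E <= FDR q theta S)%E,
    forall i, i \in true_null theta -> theta 0 i = 0 &
    forall i, i \notin true_null theta -> 0 < theta 0 i].
Proof.
move=> q0 e0 e1 eta0 a0 a1 gap um u0 tm t0 fm f0 f1 tr nr tail0.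
have P0 := Phibar_gt0 (t K).
(* The values beyond which the three lower bounds on the number of hypotheses hold; their sum
   dominates each. *)
pose A1 := (e * (Phibar (t K) / q))^-1; pose A2 := 8 / e.
pose A3 := 16 / (f 0%N * Phibar (t K) / q * e ^+ 3).
have A10 : 0 < A1 by rewrite invr_gt0 mulr_gt0// divr_gt0.
have A20 : 0 < A2 by rewrite divr_gt0.
have f3 : 0 < f 0%N * Phibar (t K) / q * e ^+ 3.
  by rewrite mulr_gt0 ?exprn_gt0// divr_gt0// mulr_gt0.
have A30 : 0 < A3 by rewrite divr_gt0.
pose n := Num.truncn (A1 + A2 + A3).
have nA : A1 + A2 + A3 < n.+1%:R by exact: truncnS_gt.
have N0 : 0 < n.+1%:R :> R by rewrite ltr0n.
have eN : 0 < e / n.+1%:R by rewrite divr_gt0.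
have [tau tau0 htau] := Phibar_small eN.
(* Then [eta / 8 / sigma >= tau], so each non-null is misplaced with probability at most
   [e / n.+1]. *)
pose sigma := Num.min (1 / 2) (eta / 8 / tau).
have sigma0 : 0 < sigma by rewrite lt_min !divr_gt0.
exists n; apply: (@band_design R q e eta a sigma K n l u t f) => //.
- have : A1 <= n.+1%:R by lra.
  have A1i : 0 < e * (Phibar (t K) / q) by rewrite mulr_gt0// divr_gt0.
  rewrite /A1 -div1r ler_pdivrMr// => h; apply: le_trans h _.
  by rewrite mulrCA !mulrA.
- have : A2 <= n.+1%:R by lra.
  by rewrite /A2 ler_pdivrMr.
- have : A3 <= n.+1%:R by lra.
  by rewrite /A3 ler_pdivrMr// => h; apply: le_trans h _; rewrite !mulrA.
- by rewrite ge_min lexx.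
- rewrite mulrC -ler_pdivlMr//; apply: le_trans htau; apply: Phibar_le.
  rewrite ler_pdivlMr// mulrC -ler_pdivlMr//.
  by rewrite ge_min lexx orbT.
Qed.

(** * Tail estimates that verify the hypotheses on the bands *)

Section numeric.
Context {R : realType}.

Lemma fine_normal_prob_itvoo (l u : R) : l <= u ->
  fine (normal_prob 0%R 1%R `]l, u[%classic) = Phibar l - Phibar u.
Proof.
move=> lu; suff h : (normal_prob 0%R 1%R `]l, u[%classic + (Phibar u)%:E =
    (Phibar l)%:E)%E.
  apply/eqP; rewrite eq_sym subr_eq eq_sym; apply/eqP.
  by apply: EFin_inj; rewrite EFinD fineK ?fin_num_measure.
move: lu; rewrite le_eqVlt => /predU1P[->|lu].
  by rewrite set_itvoo0 measure0 add0e.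
have -> : (Phibar l)%:E = normal_prob 0%R 1%R `]l, +oo[%classic.
  rewrite -Phibar_itv /normal_prob.
  rewrite -[RHS]/(\int[lebesgue_measure]_(x in `]l, +oo[) (normal_pdf 0 1 x)%:E)%E.
  rewrite integral_itv_obnd_cbnd//; exact: measurable_EFin_normal_pdf.
have -> : (`]l, +oo[ = `]l, u[ `|` `[u, +oo[)%classic.
  by rewrite -itv_bndbnd_setU ?bnd_simp.
rewrite measureU//=; last first.
  rewrite -subset0 => x []/=; rewrite !in_itv/= => /andP[_ xt].
  by rewrite andbT leNgt xt.
by rewrite -Phibar_itv.
Qed.

Lemma normal_prob_band_ge (l u c : R) : 0 <= l -> l <= u -> u <= c ->
  (u - l) * normal_pdf 0 1 c <= fine (normal_prob 0%R 1%R `]l, u[%classic).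
Proof.
move=> l0 lu uc; rewrite -lee_fin fineK ?fin_num_measure//.
apply: normal_prob_itv_ge => // x /andP[lx xu].
by rewrite ler_sqr ?nnegrE; lra.
Qed.

(** With [t = z / a] the argument on the right is [s t], and [t ^+ 2 - (s t) ^+ 2 = z ^+ 2], so
    [Phibar_mills] gives the factor. *)
Lemma null_rate_pos (a z t : R) : 0 < a -> a < 1 -> 0 <= z -> t = z / a ->
  expR (z ^+ 2 / 2) * Phibar t <= Phibar ((t - a * z) / Num.sqrt (1 - a ^+ 2)).
Proof.
move=> a0 a1 z0 tE; set s := Num.sqrt _.
have a2 : 0 < 1 - a ^+ 2 by nra.
have s0 : 0 < s by rewrite sqrtr_gt0.
have s2 : s ^+ 2 = 1 - a ^+ 2 by rewrite sqr_sqrtr// ltW.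
have s1 : s <= 1 by rewrite -(@ler_sqr _ s 1) ?nnegrE// ?(ltW s0)// s2 expr1n; nra.
have aN0 : a != 0 by rewrite gt_eqF.
have vE : (t - a * z) / s = s * t.
  have -> : t - a * z = s ^+ 2 * t by rewrite s2 tE; field.
  by rewrite expr2; field; rewrite gt_eqF.
rewrite vE.
have vt : s * t <= t by rewrite ler_piMl// tE divr_ge0// ltW.
have := Phibar_mills vt.
have -> : - (t ^+ 2 - (s * t) ^+ 2) / 2 = - (z ^+ 2 / 2).
  by rewrite exprMn s2 tE; field.
rewrite -(ler_pM2l (expR_gt0 (z ^+ 2 / 2))) mulrA -expRD subrr expR0 mul1r.
by [].
Qed.

(** For small [a] the argument on the right is at most [t + e Phibar t], as [s >= 1 - a]; the
    Lipschitz bound then costs at most [e Phibar t]. *)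
Lemma null_rate_nonpos (e a L t z : R) : 0 < e -> e <= 1 -> 0 < t -> 0 < L ->
  0 < a -> a < 1 -> a * (L + t + e * Phibar t) <= e * Phibar t -> - L <= z ->
  (1 - e) * Phibar t <= Phibar ((t - a * z) / Num.sqrt (1 - a ^+ 2)).
Proof.
move=> e0 e1 t0 L0 a0 a1 ha Lz; set s := Num.sqrt _.
have a2 : 0 < 1 - a ^+ 2 by nra.
have s0 : 0 < s by rewrite sqrtr_gt0.
have s2 : s ^+ 2 = 1 - a ^+ 2 by rewrite sqr_sqrtr// ltW.
have s1 : 1 - a <= s.
  by rewrite -(@ler_sqr _ (1 - a) s) ?nnegrE ?subr_ge0 ?(ltW s0) ?(ltW a1)// s2; nra.
have d0 : 0 < e * Phibar t by rewrite mulr_gt0// Phibar_gt0.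
apply: (@le_trans _ _ (Phibar (t + e * Phibar t))).
  have := @Phibar_lipschitz _ t (t + e * Phibar t) ltac:(lra).
  lra.
apply: Phibar_le; rewrite ler_pdivrMr//.
apply: (@le_trans _ _ ((t + e * Phibar t) * (1 - a))); last first.
  by rewrite ler_wpM2l//; lra.
nra.
Qed.

(** The Mills bound has exponent [- d (t - d / 2) <= - 2 / e], and [exp (- x) <= 1 / x]. *)
Lemma tail_ratio_ge (d e t : R) : 0 < d -> 0 < e -> 2 / (e * d) + d <= t ->
  2 * Phibar t <= e * Phibar (t - d).
Proof.
move=> d0 e0 ht; have := @Phibar_mills _ (t - d) t ltac:(lra).
set x := _ / 2 => hx.
have xE : x = - (d * (t - d / 2)) by rewrite /x; field.
have hd : 2 / e <= d * (t - d / 2).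
  have -> : 2 / e = d * (2 / (e * d)) by field; rewrite !gt_eqF.
  by rewrite ler_wpM2l ?(ltW d0)//; lra.
have hd0 : 0 < d * (t - d / 2) by apply: lt_le_trans hd; rewrite divr_gt0.
have ex : expR x <= e / 2.
  rewrite xE; apply: le_trans (expRN_le_inv hd0) _.
  by rewrite invf_ple ?posrE ?divr_gt0// invf_div.
have := ler_wpM2r (Phibar_ge0 (t - d)) ex.
lra.
Qed.

End numeric.

(** * The Riemann sum over equally spaced bands *)

Section band_grid.
Context {R : realType}.
Variables (q y e L T a : R) (K1 : nat).
Let K := K1.+1.
Let h : R := y / K%:R.
Let eta : R := h / K%:R.
Hypotheses (q_gt0 : 0 < q) (q_lt1 : q < 1) (y_gt0 : 0 < y) (yL : y <= L).
Hypothesis qy : q * expR (y ^+ 2 / 2) = 1.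
Hypotheses (K1_gt0 : (0 < K1)%N) (e_gt0 : 0 < e) (e_le : e <= 1 / 2).
Hypotheses (T_gt0 : 0 < T) (a_gt0 : 0 < a) (a_le : a <= 1 / 2).
Hypothesis T_large : 2 / (e * (eta / 4)) + eta / 4 <= T.
Hypothesis T_tail : Phibar T <= q * e / 4.
Hypothesis aT : a * T <= h.
Hypothesis aL : a * (L + T + e * Phibar T) <= e * Phibar T.

(** Band 0 runs from [- L] to just below [h], bands 1 to [K - 1] are the cells of the grid on
    [[h, y]] shortened by [eta], and band [K] is []y, L[]. At 0 the threshold [grid k / a] would
    vanish, so band 0 takes a large [T], at the price of the factor [1 - e] in [f]. *)
Let grid (k : nat) : R := k%:R * h.
Let l (k : nat) : R := if k == 0%N then - L else grid k.
Let u (k : nat) : R := if k == K then L else grid k.+1 - eta.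
Let t (k : nat) : R := if k == 0%N then T else grid k / a.
Let f (k : nat) : R :=
  if k == 0%N then q * (1 - e) else q * expR (grid k ^+ 2 / 2).

Let K_gt0 : 0 < K%:R :> R. Proof. by rewrite ltr0n. Qed.
Let K_ge2 : 2 <= K%:R :> R. Proof. by rewrite ler_nat. Qed.
Let h_gt0 : 0 < h. Proof. by rewrite divr_gt0. Qed.
Let eta_gt0 : 0 < eta. Proof. by rewrite divr_gt0. Qed.
Let eta_le : eta <= h / 2.
Proof. by rewrite ler_wpM2l ?(ltW h_gt0)// lef_pV2 ?posrE. Qed.

Let grid_le j k : (j <= k)%N -> grid j <= grid k.
Proof. by move=> jk; rewrite ler_wpM2r ?(ltW h_gt0)// ler_nat. Qed.

Let gridK : grid K = y.
Proof. by rewrite /grid /h mulrC divfK// gt_eqF. Qed.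

Let grid_ge0 k : 0 <= grid k.
Proof. by rewrite mulr_ge0// ltW. Qed.

Let gridS k : grid k.+1 = grid k + h.
Proof. by rewrite /grid -natr1 mulrDl mul1r. Qed.

Let grid_le_y k : (k <= K)%N -> grid k <= y.
Proof. by move=> kK; rewrite -gridK grid_le. Qed.

Let uE k : (k < K)%N -> u k = grid k.+1 - eta.
Proof. by move=> kK; rewrite /u ltn_eqF. Qed.

Let lE k : (0 < k)%N -> l k = grid k.
Proof. by case: k. Qed.

Let tE k : (0 < k)%N -> t k = grid k / a.
Proof. by case: k. Qed.

Let fE k : (0 < k)%N -> f k = q * expR (grid k ^+ 2 / 2).
Proof. by case: k. Qed.

Let fK : f K = 1.
Proof. by rewrite fE// gridK. Qed.

Let f_mono j k : (j <= k <= K)%N -> f j <= f k.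
Proof.
move=> /andP[jk _]; case: k jk => [|k]; first by rewrite leqn0 => /eqP ->.
rewrite (fE (ltn0Sn k)); case: j => [_|j jk].
  rewrite ler_wpM2l ?(ltW q_gt0)//.
  have : 1 <= expR (grid k.+1 ^+ 2 / 2).
    by rewrite -expR0 ler_expR divr_ge0 ?sqr_ge0.
  by have := e_gt0; lra.
rewrite (fE (ltn0Sn j)) ler_wpM2l ?(ltW q_gt0)// ler_expR ler_wpM2r//.
by rewrite ler_sqr ?nnegrE ?grid_ge0 ?grid_le.
Qed.

Let t_mono j k : (j <= k <= K)%N -> t j <= t k.
Proof.
move=> /andP[jk _]; case: k jk => [|k]; first by rewrite leqn0 => /eqP ->.
rewrite (tE (ltn0Sn k)); case: j => [_|j jk].
  rewrite ler_pdivlMr// mulrC; apply: le_trans aT _.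
  by rewrite gridS lerDr grid_ge0.
by rewrite (tE (ltn0Sn j)) ler_wpM2r ?invr_ge0 ?(ltW a_gt0)// grid_le.
Qed.

Let u_mono j k : (j <= k <= K)%N -> u j <= u k.
Proof.
move=> /andP[jk kK]; have [jK|] := ltnP j K; last first.
  by move=> Kj; have -> : j = k by apply/eqP; rewrite eqn_leq jk (leq_trans kK).
rewrite uE// {1}/u; have := eta_gt0; case: eqP => [_|/eqP kNK] e0.
  by have := grid_le_y jK; have := yL; rewrite /u; lra.
by rewrite lerD2r grid_le.
Qed.

Let FDR_sum_le :
  exists (n : nat) (theta : 'rV[R]_n.+1) (S : 'M[R]_n.+1),
  [/\ correlation_mx S,
    ((\sum_(k < K.+1) (f k - 4 * e) *
       fine (normal_prob 0%R 1%R `]l k, u k[%classic))%:E <= FDR q theta S)%E,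
    forall i, i \in true_null theta -> theta 0 i = 0 &
    forall i, i \notin true_null theta -> 0 < theta 0 i].
Proof.
have e1 : e <= 1 by have := e_le; lra.
have a1 : a < 1 by have := a_le; lra.
apply: (@band_design_large R q e eta a K l u t f) => //.
- move=> j k /andP[jk kK]; rewrite uE ?(leq_trans jk)// lE ?(leq_ltn_trans _ jk)//.
  by rewrite subrK grid_le.
- move=> k kK; rewrite /u; case: eqP => _; first by have := y_gt0; have := yL; lra.
  by rewrite gridS; have := grid_ge0 k; have := eta_le; have := h_gt0; lra.
- by rewrite /f/= mulr_gt0//; have := e_le; lra.
- by move=> k kK; rewrite -fK f_mono// kK leqnn.
- move=> k kK; apply: tail_ratio_ge; rewrite ?divr_gt0//.
  by apply: le_trans T_large _; apply: (@t_mono 0%N k); rewrite kK.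
- move=> k z kK; case: k kK => [_|k kK].
    rewrite /l /f /t/= => Lz _; rewrite -mulrA ler_wpM2l ?(ltW q_gt0)//.
    apply: (@null_rate_nonpos _ e a L) => //; last exact: ltW.
    by have := y_gt0; have := yL; lra.
  rewrite lE// fE// => lz _; rewrite -mulrA ler_wpM2l ?(ltW q_gt0)//.
  (* The exceedance probability of a null increases with [z], so the left end of the band is the
     worst case. *)
  apply: le_trans (null_rate_pos a_gt0 a1 (grid_ge0 _) (tE (ltn0Sn _))) _.
  apply: Phibar_le; rewrite ler_wpM2r ?invr_ge0 ?sqrtr_ge0// lerD2l lerN2.
  by rewrite ler_wpM2l ?(ltW a_gt0)// ltW.
Qed.

Let phi0 : R := normal_pdf 0 1 0.

Let pdf_expR (c : R) : normal_pdf 0 1 c = phi0 * expR (- (c ^+ 2 / 2)).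
Proof.
rewrite /phi0 !normal_pdf01E expr0n/= oppr0 mul0r expR0 mulr1.
by congr (_ * expR _); rewrite mulNr.
Qed.

Let phi0_ge0 : 0 <= phi0. Proof. exact: normal_pdf_ge0. Qed.

Let P (k : nat) : R := fine (normal_prob 0%R 1%R `]l k, u k[%classic).

Let P_ge0 k : 0 <= P k. Proof. by rewrite fine_ge0. Qed.

Let P_le1 k : P k <= 1.
Proof. by rewrite -lee_fin fineK ?fin_num_measure//; exact: probability_le1. Qed.

(** [q exp (z ^+ 2 / 2)] times the density is the constant [q phi0]. Taking the first factor at the
    left end of a cell and the density at the right end costs at most [exp (- y ^+ 2 / K)], by
    [grid_sq]. *)
Let slab : R := q * (phi0 * ((h - eta) * expR (- (y ^+ 2 / K%:R)))).

Let grid_sq k : (k < K)%N -> grid k.+1 ^+ 2 - grid k ^+ 2 <= 2 * (y ^+ 2 / K%:R).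
Proof.
move=> kK; rewrite subr_sqr {1}gridS [grid k + h]addrC addrK.
have -> : 2 * (y ^+ 2 / K%:R) = h * (y + y) by rewrite /h; ring.
rewrite ler_wpM2l ?(ltW h_gt0)//.
by rewrite lerD ?grid_le_y// ltnW.
Qed.

Let middle_band k : (0 < k < K)%N -> slab <= f k * P k.
Proof.
move=> /andP[k0 kK]; rewrite fE// /slab -[leRHS]mulrA ler_wpM2l ?(ltW q_gt0)//.
have h1 : (h - eta) * normal_pdf 0 1 (grid k.+1) <= P k.
  have -> : h - eta = u k - l k by rewrite uE// lE// gridS; ring.
  have e0 := eta_gt0; have := eta_le; have := h_gt0 => h0 eh.
  apply: normal_prob_band_ge; rewrite ?uE ?lE ?grid_ge0 ?gridS//; lra.
apply: (@le_trans _ _ (expR (grid k ^+ 2 / 2) *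
    ((h - eta) * normal_pdf 0 1 (grid k.+1)))); last first.
  by rewrite ler_wpM2l ?expR_ge0.
rewrite pdf_expR.
have -> : expR (grid k ^+ 2 / 2) * ((h - eta) * (phi0 * expR (- (grid k.+1 ^+ 2 / 2))))
  = phi0 * ((h - eta) * expR (grid k ^+ 2 / 2 - grid k.+1 ^+ 2 / 2)).
  by rewrite expRD; ring.
rewrite ler_wpM2l// ler_wpM2l//.
  by have := eta_le; have := h_gt0; lra.
by rewrite ler_expR; have := grid_sq kK; lra.
Qed.

(** The negative half of the band yields [q / 2] up to the tail beyond [L], and [[0, h - eta[]
    yields one more slab. *)
Let first_band : q / 2 + slab - Phibar L - e <= f 0%N * P 0%N.
Proof.
have h0 := h_gt0; have eh := eta_le; have e0 := eta_gt0.
have uh : u 0%N = h - eta by rewrite uE// /grid mul1r.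
have heta : 0 <= h - eta by lra.
have PE : P 0%N = 1 - Phibar L - Phibar (h - eta).
  rewrite /P uh /l/= fine_normal_prob_itvoo ?PhibarN//.
  by have := yL; have := y_gt0; lra.
have h1 : slab <= q * (2^-1 - Phibar (h - eta)).
  rewrite /slab ler_wpM2l ?(ltW q_gt0)// -Phibar0 -fine_normal_prob_itvoo//.
  have hh : h - eta <= h by lra.
  apply: le_trans (normal_prob_band_ge (lexx 0) heta hh).
  rewrite subr0 pdf_expR [leRHS]mulrCA ler_wpM2l// ler_wpM2l// ler_expR.
  have := @grid_sq 0%N isT; rewrite /grid mul0r mul1r expr0n/= subr0; lra.
have q1 : q * Phibar L <= Phibar L by rewrite ler_piMl ?Phibar_ge0// ltW.
have eP : q * e * P 0%N <= e.
  rewrite -[leRHS]mulr1 ler_pM ?P_le1 ?mulr_ge0 ?(ltW q_gt0) ?(ltW e_gt0)//.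
  by rewrite ler_piMl// ltW.
have -> : f 0%N * P 0%N = q * P 0%N - q * e * P 0%N by rewrite /f/=; ring.
rewrite {1}PE; lra.
Qed.

Let last_band : f K * P K = Phibar y - Phibar L.
Proof. by rewrite fK mul1r /P /u eqxx lE// gridK fine_normal_prob_itvoo. Qed.

(** One slab comes from band 0 and [K1] from the middle bands, [K] in all. The errors are [e] from
    band 0 and [4 e] times at most [K + 1]. *)
Let sum_bands_ge : q / 2 + K%:R * slab + Phibar y - 2 * Phibar L -
    e * (4 * K%:R + 5) <= \sum_(k < K.+1) (f k - 4 * e) * P k.
Proof.
have -> : \sum_(k < K.+1) (f k - 4 * e) * P k =
    \sum_(k < K.+1) f k * P k - 4 * e * \sum_(k < K.+1) P k.
  by rewrite mulr_sumr -sumrB; apply: eq_bigr => k _; rewrite mulrBl.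
have sP : \sum_(k < K.+1) P k <= K%:R + 1.
  apply: (@le_trans _ _ (\sum_(k < K.+1) 1)); last by rewrite sumr_const card_ord natr1.
  by apply: ler_sum => k _; exact: P_le1.
have eP : e * \sum_(k < K.+1) P k <= e * (K%:R + 1) by rewrite ler_wpM2l ?(ltW e_gt0).
have S1_ge : q / 2 + slab - Phibar L - e + (K1%:R * slab + (Phibar y - Phibar L)) <=
    \sum_(k < K.+1) f k * P k.
  rewrite big_ord_recl; apply: lerD; first exact: first_band.
  rewrite big_ord_recr; apply: lerD; last by rewrite -last_band.
  apply: (@le_trans _ _ (\sum_(k < K1) slab)); first by rewrite sumr_const card_ord mulr_natl.
  by apply: ler_sum => k _; apply: middle_band; rewrite /bump/= ltnS.
have lin (k s S1 S2 c b z : R) : e * S2 <= e * (k + 1 + 1) ->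
    c + s - z - e + (k * s + (b - z)) <= S1 ->
    c + (k + 1) * s + b - 2 * z - e * (4 * (k + 1) + 5) <= S1 - 4 * e * S2.
  by lra.
have KE : K%:R = K1%:R + 1 :> R by rewrite natr1.
by rewrite KE in eP *; exact: lin eP S1_ge.
Qed.

Lemma band_grid_FDR_ge :
  exists (n : nat) (theta : 'rV[R]_n.+1) (S : 'M[R]_n.+1),
  [/\ correlation_mx S,
    ((q / 2 +
       K%:R * (q * (phi0 * ((h - eta) * expR (- (y ^+ 2 / K%:R))))) +
       Phibar y - 2 * Phibar L - e * (4 * K%:R + 5))%:E <= FDR q theta S)%E,
    forall i, i \in true_null theta -> theta 0 i = 0 &
    forall i, i \notin true_null theta -> 0 < theta 0 i].
Proof.
have [n [theta [S [corS FDRS null0 nonnull0]]]] := FDR_sum_le.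
exists n, theta, S; split => //; apply: le_trans FDRS.
by rewrite lee_fin; exact: sum_bands_ge.
Qed.

End band_grid.

Theorem theorem3p1 (R : realType) (q delta : R)
    (hq0 : 0 < q) (hq1 : q < 1) (hdelta : 0 < delta) :
  exists (N : nat) (theta : 'rV[R]_N) (S : 'M[R]_N),
    [/\ (0 < N)%N,
        correlation_mx S,
        ((ell_le q - delta)%:E < FDR q theta S)%E,
        forall i, i \in true_null theta -> theta 0 i = 0 &
        forall i, i \notin true_null theta -> 0 < theta 0 i].
Proof.
set y := y_plus q.
have iq : 1 < 1 / q by rewrite ltr_pdivlMr// mul1r.
have ln0 : 0 < ln (1 / q) by rewrite ln_gt0.
have y0 : 0 < y by rewrite sqrtr_gt0 mulr_gt0.
have y2 : y ^+ 2 = 2 * ln (1 / q) by rewrite sqr_sqrtr// mulr_ge0// ltW.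
have qy : q * expR (y ^+ 2 / 2) = 1.
  rewrite y2 (_ : 2 * ln (1 / q) / 2 = ln (1 / q)); last by field.
  rewrite lnK ?posrE ?divr_gt0//.
  by rewrite mul1r divff// gt_eqF.
set phi0 : R := normal_pdf 0 1 0.
have phi0E : phi0 = (Num.sqrt (pi *+ 2))^-1.
  by rewrite /phi0 normal_pdf01E expr0n/= oppr0 mul0r expR0 mulr1.
have phi0_ge0 : 0 <= phi0 by exact: normal_pdf_ge0.
have ellE : ell_le q = q * phi0 * y + q / 2 + Phibar y.
  rewrite /ell_le -/y; congr (_ + _ + _); rewrite phi0E /y /y_plus.
  rewrite (_ : pi *+ 2 = pi * 2); last by rewrite mulr_natr.
  rewrite !sqrtrM ?pi_ge0//; field.
  by rewrite !gt_eqF ?sqrtr_gt0 ?pi_gt0.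
(* [D / K] bounds the loss of the Riemann sum, since [(1 - 1 / K) exp (- y ^+ 2 / K) >= 1 - (1 + y
   ^+ 2) / K]; the factor [1 - 1 / K] accounts for the gaps [eta]. *)
pose D := q * phi0 * y * (1 + y ^+ 2).
have D0 : 0 <= D.
  by rewrite !mulr_ge0 ?(ltW hq0) ?(ltW y0)// addr_ge0 ?sqr_ge0.
pose K1 := (Num.truncn (4 * D / delta)).+1; pose K : R := K1.+1%:R.
have K_gt0 : 0 < K by rewrite ltr0n.
have DK : D / K <= delta / 4.
  have : 4 * D / delta <= K.
    by rewrite (le_trans (ltW (truncnS_gt _)))// ler_nat.
  by rewrite ler_pdivrMr// ler_pdivrMr// => h; lra.
have [L0 L0_gt0 hL0] := @Phibar_small R (delta / 8) ltac:(lra).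
pose L := y + L0.
have yL : y <= L by rewrite lerDl ltW.
have hL : Phibar L <= delta / 8 by apply: le_trans hL0; apply: Phibar_le; rewrite lerDr ltW.
have K5 : 0 < 4 * (4 * K + 5) by lra.
pose e := Num.min (1 / 2) (delta / (4 * (4 * K + 5))).
have e_gt0 : 0 < e by rewrite lt_min !divr_gt0.
have e_le : e <= 1 / 2 by rewrite ge_min lexx.
have eK : e * (4 * K + 5) <= delta / 4.
  have : e <= delta / (4 * (4 * K + 5)) by rewrite ge_min lexx orbT.
  by rewrite ler_pdivlMr// => h; lra.
pose h := y / K; pose eta := h / K.
have h_gt0 : 0 < h by rewrite divr_gt0.
have eta_gt0 : 0 < eta by rewrite divr_gt0.
have qe4 : 0 < q * e / 4 by rewrite divr_gt0// mulr_gt0.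
have [T1 T1_gt0 hT1] := Phibar_small qe4.
have B0 : 0 < 2 / (e * (eta / 4)) + eta / 4.
  by rewrite addr_gt0 ?divr_gt0// mulr_gt0// divr_gt0.
pose T := T1 + (2 / (e * (eta / 4)) + eta / 4).
have T_gt0 : 0 < T by rewrite addr_gt0.
have T_tail : Phibar T <= q * e / 4.
  by apply: le_trans hT1; apply: Phibar_le; rewrite lerDl ltW.
have T_large : 2 / (e * (eta / 4)) + eta / 4 <= T by rewrite lerDr ltW.
have eP : 0 < e * Phibar T by rewrite mulr_gt0// Phibar_gt0.
have L_gt0 : 0 < L by rewrite addr_gt0.
have LT : 0 < L + T + e * Phibar T by rewrite addr_gt0// addr_gt0.
(* The bound [h / T] puts the threshold [h / a] of band 1 above [T]; the last bound is the one
   needed by [null_rate_nonpos]. *)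
pose a := Num.min (1 / 2) (Num.min (h / T) (e * Phibar T / (L + T + e * Phibar T))).
have a_gt0 : 0 < a by rewrite !lt_min !divr_gt0.
have a_le : a <= 1 / 2 by rewrite ge_min lexx.
have aT : a * T <= h.
  by rewrite -ler_pdivlMr// !ge_min lexx orbT.
have aL : a * (L + T + e * Phibar T) <= e * Phibar T.
  by rewrite -ler_pdivlMr// !ge_min lexx !orbT.
have [n [theta [S [corS FDRS null0 nonnull0]]]] :=
  @band_grid_FDR_ge R q y e L T a K1 hq0 hq1 y0 yL qy isT e_gt0 e_le T_gt0
    a_gt0 a_le T_large T_tail aT aL.
exists n.+1, theta, S; split => //; apply: lt_le_trans FDRS; rewrite lte_fin.
rewrite -/K -/h -/eta -/phi0 ellE.
have slabs : q * phi0 * y - D / K <=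
    K * (q * (phi0 * ((h - eta) * expR (- (y ^+ 2 / K))))).
  have -> : K * (q * (phi0 * ((h - eta) * expR (- (y ^+ 2 / K))))) =
      q * phi0 * y * ((1 - K^-1) * expR (- (y ^+ 2 / K))).
    by rewrite /eta /h; field; rewrite gt_eqF.
  have -> : q * phi0 * y - D / K = q * phi0 * y * (1 - (1 + y ^+ 2) / K).
    by rewrite /D; ring.
  rewrite ler_wpM2l//; first by rewrite !mulr_ge0// ltW.
  have Ki : 0 <= K^-1 by rewrite invr_ge0 ltW.
  have K1' : 0 <= 1 - K^-1 by rewrite subr_ge0 invf_le1// ler1n.
  apply: (@le_trans _ _ ((1 - K^-1) * (1 - y ^+ 2 / K))).
    have -> : (1 - K^-1) * (1 - y ^+ 2 / K) =
      1 - (1 + y ^+ 2) / K + K^-1 * (y ^+ 2 / K) by ring.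
    by rewrite lerDl mulr_ge0// divr_ge0 ?sqr_ge0// ltW.
  by rewrite ler_wpM2l// expR_ge1Dx.
(* Error budget: [delta / 4] for the Riemann sum, [2 * delta / 8] for the tails beyond [L] and
   [delta / 4] for the terms in [e], which is less than [delta]. *)
have lin (A B C X z E Dk : R) : A - Dk <= X -> Dk <= delta / 4 ->
    z <= delta / 8 -> E <= delta / 4 ->
    A + B + C - delta < B + X + C - 2 * z - E by lra.
exact: lin slabs DK hL eK.
Qed.
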